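(* Let $(X,d)$ be an $n$-point metric space and let $h$ be a chaining functional of log-concave type with $|h'(1)|=1$ (left derivative). Then $$\gamma^*_h(X)-\mathbf D(X)\;\le\;\delta_h(X)\;\le\;2\gamma^*_h(X)+\mathbf D(X)/e .$$ Furthermore, given any probability measure $\nu$ on $X$, one can compute a nonempty set $S\subseteq\{x\in X:\nu(x)>0\}$ satisfying $$\int_X\int_0^\infty h(\nu(B(x,r)))\,dr\,d\nu(x)\;\le\;\min_{x\in S}\int_0^\infty h(\nu_S(B(x,r)))\,dr\;+\;\mathbf D(X),$$ using at most $O(n^3)$ arithmetic operations and evaluations of $h$.
   Context: $B(x,r)=\{y\in X: d(x,y)\le r\}$ and $\mathbf D(X)=\max_{u,v\in X}d(u,v)$; $e$ is the base of the natural logarithm. For $S\subseteq X$ with $\nu(S)>0$, $\nu_S$ is the conditional probability measure $\nu_S(A)=\nu(A\cap S)/\nu(S)$ for $A\subseteq X$. Chaining functional: let $f:[0,\infty)\to[0,\infty)$ be a continuous, non-increasing probability density on $[0,\infty)$ and let $F(s)=\int_s^\infty f(t)\,dt$. The chaining functional induced by $f$ is $h(p)=F^{-1}(p)$ for $p\in(0,1]$ (so $h(1)=0$ and $h$ is strictly decreasing and convex). It is of log-concave type if $f$ is log-concave. The normalization $|h'(1)|=1$ is equivalent to $f(0)=1$. We read $h(0)=\lim_{p\to0^+}h(p)\in(0,\infty]$ and $0\cdot\infty=0$. With $\mu,\nu$ ranging over all probability measures on $X$, the dual program and the simplified dual are $$\gamma^*_h(X)=\max_{\nu}\min_{\mu}\int_X\int_0^\infty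 h(\mu(B(x,r)))\,dr\,d\nu(x),\qquad \delta_h(X)=\max_\nu\ \min_{x\in X,\ \nu(x)>0}\int_0^\infty h(\nu(B(x,r)))\,dr,$$ where the maxima over $\nu$ and minima over $\mu$ are understood as suprema and infima. *)

(* Defs.v *)
From HB Require Import structures.
From mathcomp Require Import all_boot all_order all_algebra.
From mathcomp Require Import all_classical all_reals all_analysis.
Import Order.TTheory GRing.Theory Num.Theory.
Import numFieldNormedType.Exports.

Set Implicit Arguments.
Unset Strict Implicit.
Unset Printing Implicit Defensive.

Local Open Scope classical_set_scope.
Local Open Scope ring_scope.

Section Chaining.
Variable R : realType.
Implicit Types (f h : R -> R) (p s t x y : R).

(* Only the values of f on [0, +oo[ matter. *)
Definition chaining_density f : Prop :=
  [/\ forall t, 0 <= t -> 0 <= f t,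
      {within `[0, +oo[, continuous f},
      forall s t, 0 <= s -> s <= t -> f t <= f s &
      (\int[@lebesgue_measure R]_(t in `[0%R, +oo[) (f t)%:E = 1)%E].

Definition tail f s : \bar R :=
  (\int[@lebesgue_measure R]_(t in `[s, +oo[) (f t)%:E)%E.

(* h is the inverse of the tail F of f on ]0, 1]; the values of h outside of
   ]0, 1] are arbitrary.  Since f is non-increasing, F is injective where it is
   positive, so f determines h on ]0, 1]. *)
Definition chaining_functional f h : Prop :=
  chaining_density f /\
  forall p, 0 < p -> p <= 1 -> 0 <= h p /\ tail f (h p) = p%:E.

(* As 0 `^ t = 0 for t > 0 and 0 `^ 0 = 1, this also covers zeros of f. *)
Definition log_concave f : Prop :=
  forall x y t, 0 <= x -> 0 <= y -> 0 <= t -> t <= 1 ->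
    f x `^ (1 - t) * f y `^ t <= f ((1 - t) * x + t * y).

(* |h'(1)| = 1, where h'(1) is the left derivative. *)
Definition normalized h : Prop :=
  exists2 l : R, (h (1 + t) - h 1) / t @[t --> 0^'-] --> l & `|l| = 1.

(* h extended by h(0) = lim_(p -> 0+) h(p), which may be +oo. *)
Definition chaining_ext h p : \bar R :=
  if 0 < p then (h p)%:E else lim ((h q)%:E @[q --> 0^'+]).

End Chaining.

Section FiniteMetric.
Variables (R : realType) (X : finType).
Implicit Types (d : X -> X -> R) (mu nu : X -> R) (x y z : X) (A S : {set X}).

Definition is_metric d : Prop :=
  [/\ forall x y, 0 <= d x y,
      forall x y, d x y = 0 <-> x = y,
      forall x y, d x y = d y x &
      forall x y z, d x z <= d x y + d y z].

Definition cball d x (r : R) : {set X} := finset (fun y => d x y <= r).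

Definition diam d : R := \big[Num.max/0]_u \big[Num.max/0]_v d u v.

(* A probability measure on the finite set X is given by its point masses;
   [meas nu A] is then the measure of A. *)
Definition is_prob nu : Prop := (forall x, 0 <= nu x) /\ \sum_x nu x = 1.

Definition meas nu A : R := \sum_(x in A) nu x.

Definition cond_meas nu S A : R := meas nu (A :&: S) / meas nu S.

Variable h : R -> R.

(* The argument m is a set function: [meas nu] or [cond_meas nu S]. *)
Definition chain_int d (m : {set X} -> R) x : \bar R :=
  (\int[@lebesgue_measure R]_(r in `[0%R, +oo[)
      chaining_ext h (m (cball d x r)))%E.

(* The product in \bar R satisfies 0 * +oo = 0. *)
Definition avg_chain_int d mu nu : \bar R :=
  (\sum_x (nu x)%:E * chain_int d (meas mu) x)%E.

Definition gamma_dual d : \bar R :=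
  ereal_sup [set ereal_inf [set avg_chain_int d mu nu | mu in is_prob]
            | nu in is_prob].

Definition delta_dual d : \bar R :=
  ereal_sup [set \big[mine/+oo%E]_(x | 0 < nu x) chain_int d (meas nu) x
            | nu in is_prob].

End FiniteMetric.

(* Programs of a real RAM with an oracle.  A program is a finite syntactic
   object that does not depend on the input.  The memory consists of countably many arrays of natural numbers and countably
   many arrays of reals, of unbounded length; the arrays are named by constants,
   cells are addressed by computed indices.  A program can inspect reals only
   through the tests [RLe]; the only real constants are natural numbers. *)

Inductive iop := IAdd | ISub | IMul.
Inductive rop := RAdd | RSub | RMul | RDiv.

Inductive iexp :=
| ICst of nat
| IGet of nat & iexp
| IBin of iop & iexp & iexp.

Inductive rexp :=
| RCst of nat
| RGet of nat & iexp
| RBin of rop & rexp & rexp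
| ROracle of rexp.

Inductive bexp :=
| ILe of iexp & iexp
| RLe of rexp & rexp.

Inductive cmd :=
| Skip
| ISet of nat & iexp & iexp  (* ISet a i e : cell i of array a gets value e *)
| RSet of nat & iexp & rexp
| Seq of cmd & cmd
| If of bexp & cmd & cmd
| While of bexp & cmd.

(* Every constant, memory access, arithmetic operation, comparison and oracle
   call costs one unit. *)
Fixpoint icost (e : iexp) : nat :=
  match e with
  | ICst _ => 1
  | IGet _ i => (icost i).+1
  | IBin _ e1 e2 => (icost e1 + icost e2).+1
  end.

Fixpoint rcost (e : rexp) : nat :=
  match e with
  | RCst _ => 1
  | RGet _ i => (icost i).+1
  | RBin _ e1 e2 => (rcost e1 + rcost e2).+1
  | ROracle e1 => (rcost e1).+1
  end.

Definition bcost (b : bexp) : nat :=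
  match b with
  | ILe e1 e2 => (icost e1 + icost e2).+1
  | RLe e1 e2 => (rcost e1 + rcost e2).+1
  end.

Section RealRAM.
Variable R : realType.

Record state := State { imem : nat -> nat -> nat; rmem : nat -> nat -> R }.

Definition upd (T : Type) (m : nat -> nat -> T) (a i : nat) (v : T) :=
  fun b j => if (b == a) && (j == i) then v else m b j.

(* Subtraction is truncated. *)
Definition iop_eval (o : iop) (m n : nat) : nat :=
  match o with IAdd => m + n | ISub => m - n | IMul => m * n end%N.

(* x / 0 = 0. *)
Definition rop_eval (o : rop) (x y : R) : R :=
  match o with
  | RAdd => x + y | RSub => x - y | RMul => x * y | RDiv => x / y
  end.

Fixpoint ieval (s : state) (e : iexp) : nat :=
  match e with
  | ICst k => k
  | IGet a i => imem s a (ieval s i)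
  | IBin o e1 e2 => iop_eval o (ieval s e1) (ieval s e2)
  end.

Variable h : R -> R.

Fixpoint reval (s : state) (e : rexp) : R :=
  match e with
  | RCst k => k%:R
  | RGet a i => rmem s a (ieval s i)
  | RBin o e1 e2 => rop_eval o (reval s e1) (reval s e2)
  | ROracle e1 => h (reval s e1)
  end.

Definition beval (s : state) (b : bexp) : bool :=
  match b with
  | ILe e1 e2 => (ieval s e1 <= ieval s e2)%N
  | RLe e1 e2 => reval s e1 <= reval s e2
  end.

(* [exec c s s' k]: started in s, c halts in s' after k steps. *)
Inductive exec : cmd -> state -> state -> nat -> Prop :=
| ExecSkip s : exec Skip s s 1
| ExecISet a i e s :
    exec (ISet a i e) s
         (State (upd (imem s) a (ieval s i) (ieval s e)) (rmem s))
         (icost i + icost e).+1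
| ExecRSet a i e s :
    exec (RSet a i e) s
         (State (imem s) (upd (rmem s) a (ieval s i) (reval s e)))
         (icost i + rcost e).+1
| ExecSeq c1 c2 s s1 s2 k1 k2 :
    exec c1 s s1 k1 -> exec c2 s1 s2 k2 ->
    exec (Seq c1 c2) s s2 (k1 + k2)
| ExecIf b c1 c2 s s' k :
    exec (if beval s b then c1 else c2) s s' k ->
    exec (If b c1 c2) s s' (bcost b + k).+1
| ExecWhileF b c s :
    beval s b = false -> exec (While b c) s s (bcost b).+1
| ExecWhileT b c s s1 s2 k1 k2 :
    beval s b = true -> exec c s s1 k1 -> exec (While b c) s1 s2 k2 ->
    exec (While b c) s s2 (bcost b + k1 + k2).+1.

Variable X : finType.

(* Input: cell 0 of integer array 0 holds n = #|X|, real array 0 holds the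
   distance matrix row by row, real array 1 holds the point masses of nu.  All
   other cells have unspecified contents. *)
Definition holds_input (d : X -> X -> R) (nu : X -> R) (s : state) : Prop :=
  [/\ imem s 0 0 = #|X|,
      forall x y, rmem s 0 (enum_rank x * #|X| + enum_rank y)%N = d x y &
      forall x, rmem s 1 (enum_rank x) = nu x].

(* Output: the nonzero cells of integer array 1 mark the points of the set. *)
Definition output_set (s : state) : {set X} :=
  finset (fun x => imem s 1 (enum_rank x) != 0%N).

End RealRAM.

(* Main.v *)
Require Import Defs.
From HB Require Import structures.
From mathcomp Require Import all_boot all_order all_algebra.
From mathcomp Require Import all_classical all_reals all_analysis.
From mathcomp Require Import lra ring zify.
Import Order.TTheory GRing.Theory Num.Theory.
Import numFieldNormedType.Exports measurable_realfun.
Local Open Scope ring_scope.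

(** Write [F] for the tail of [f] and, for a point [x] and a measure [m], write
    [A_m x] for the chaining integral at [x].

    Only four facts about [h] matter, collected in [chaining_profile]:
    [h 1 = 0], [h] is non-increasing, [h (p q) <= h p + h q], and
    [h p <= - ln p].  Log-concavity gives [f w * f v <= f (s + v) * f (w - s)] for
    [v <= w - s]; integrating this over [v < t <= w - s] yields
    [F (s + t) <= F s * F t], which is the third fact read through the inverse
    ([tail_submultiplicative], [functional_mul]).  Applying it to the n-th root
    of [p] and letting n grow turns the normalization at 1 into the fourth
    ([functional_le_ln]).

    Upper bound on [delta]: fix [nu] and compare it with an arbitrary [mu].  With
    [a = nu (B x (2 r))] and [b = mu (B x r)] one has
    [h a <= h b + ln^+ (b / a) <= h b + (b / a) / e].  Every
    [x] in [B y r] satisfies [B y r <= B x (2 r)], so the [nu]-average of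
    [b / a] is at most 1 ([sum_ratio_le1]).  Only radii below [diam / 2] contribute,
    and doubling the radius costs a factor 2: the [nu]-average of [A_nu] is at
    most [2 * \sum_x nu x * A_mu x + diam / e] for every [mu] ([self_avg_le]), and
    it dominates the minimum of [A_nu] on the support.

    Lower bound on [delta] and the set [S]: let [T] be the [nu]-average of [A_nu]
    minus the diameter, and, starting with the support of [nu], remove points [x]
    of the current set [S] with [A_(nu_S) x < T].  Since
    [A_nu x <= A_(nu_S) x + diam * h (nu S)] and [h (nu S) <= - ln (nu S)], the
    removed points contribute less to the average of [A_nu] than
    [T * removed mass + diam * \int - ln p dp], the integral running from the
    remaining mass to 1 ([peeled_step]).  If everything were removed, the
    integral would be 1 and the average would be less than [T + diam], that is,
    less than itself ([peeled_neq0]).  So the process stops at a nonempty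
    set, which is the one sought ([well_spread]).

    Running time: [A_m x] is a finite sum over [y] of a gap, independent of [m],
    times [h (m (B x (d x y)))] ([integral_ball_steps]).  The gaps and the masses
    [nu (B x (d x y) :&: S)] are tabulated once in cubic time; a search for a
    removable point and the update of the table after a removal then take
    quadratic time, and there are at most [n] removals.  The cost of a program
    made of loops bounded by [n] is read off its syntax ([cost_bound]). *)

Set Implicit Arguments.
Unset Strict Implicit.
Unset Printing Implicit Defensive.

(** * Tails of log-concave densities *)

Section Tail.
Local Open Scope classical_set_scope.
Variable R : realType.
Implicit Types (a s t u v x p q : R).
Notation mu := (@lebesgue_measure R).

Lemma integral_shift (G : R -> R) (a s : R) :
  {within `[a + s, +oo[, continuous G} ->
  (forall x, a + s <= x -> 0 <= G x) ->
  (\int[mu]_(x in `[(a + s)%R, +oo[) (G x)%:E =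
   \int[mu]_(x in `[a, +oo[) (G (x + s))%:E)%E.
Proof.
move=> cG G0.
have D1 : (fun x : R => x + s)^`()%classic = cst 1.
  by apply/funext => x; rewrite derive1E;
    have := derive_shift (1 : R) s; move/(congr1 (@^~ x)).
rewrite (@increasing_ge0_integration_by_substitutiony R (fun x => x + s) G a) //.
- by apply: eq_integral => x _; rewrite !fctE D1 /= mulr1.
- by move=> x y _ _ /=; rewrite ltrD2r.
- by rewrite D1 => x _; apply: cst_continuous.
- rewrite D1; apply: is_cvg_cst.
- rewrite D1; apply: is_cvg_cst.
- split.
  + by move=> x _ /=; apply: derivableD; [exact: derivable_id|exact: derivable_cst].
  + apply: cvg_at_right_filter; apply: cvgD; [exact: cvg_id|exact: cvg_cst].
- apply/cvgryPge => A; near=> x; rewrite -lerBlDr; near: x.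
  by apply: nbhs_pinfty_ge; rewrite num_real.
- by move=> x /=; rewrite in_itv /= andbT => /ltW /G0.
Unshelve. all: by end_near. Qed.

Variable f : R -> R.
Hypothesis fd : chaining_density f.

Lemma density_measurable (i : interval R) : [set` i] `<=` `[0, +oo[ ->
  measurable_fun [set` i] (fun x : R => (f x)%:E).
Proof.
move=> sub; apply/measurable_EFinP.
apply: (measurable_funS _ sub) => //.
by case: fd => _ cf _ _; exact: subspace_continuous_measurable_fun.
Qed.

Lemma density_ge0 t : 0 <= t -> 0 <= f t.
Proof. by case: fd => + _ _ _; exact. Qed.

Lemma subset_half s (b : bool) (c : itv_bound R) : 0 <= s ->
  [set` Interval (BSide b s) c] `<=` `[0, +oo[.
Proof.
move=> s0 x /=; rewrite !itv_boundlr /= !bnd_simp => /andP[+ _]; rewrite andbT.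
by case: b; rewrite bnd_simp => ?; lra.
Qed.

Lemma tail_ge0 s : 0 <= s -> (0 <= tail f s)%E.
Proof.
move=> s0; apply: integral_ge0 => x /=; rewrite in_itv /= andbT => sx.
by rewrite lee_fin density_ge0// (le_trans s0).
Qed.

Lemma tail0 : tail f 0 = 1%E. Proof. by case: fd. Qed.

Lemma tail_split s t : 0 <= s -> s <= t ->
  (tail f s = \int[mu]_(x in `[s, t[) (f x)%:E + tail f t)%E.
Proof.
move=> s0 st; rewrite /tail -ge0_integral_setU //.
- by rewrite -itv_bndbnd_setU // bnd_simp.
- rewrite -itv_bndbnd_setU ?bnd_simp//; apply: density_measurable; exact: subset_half.
- rewrite -itv_bndbnd_setU ?bnd_simp//= => x; rewrite in_itv /= andbT => sx.
  by rewrite lee_fin density_ge0// (le_trans s0).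
- apply/disj_setPS => x [] /=; rewrite !in_itv /= andbT => /andP[_ xt] tx.
  by have := lt_le_trans xt tx; rewrite ltxx.
Qed.

Lemma tail_le1 s : 0 <= s -> (tail f s <= 1)%E.
Proof.
move=> s0; rewrite -tail0 (tail_split (lexx 0) s0) leeDr//.
apply: integral_ge0 => x /=; rewrite in_itv /= => /andP[x0 _].
by rewrite lee_fin density_ge0.
Qed.

Lemma tail_fin s : 0 <= s -> tail f s \is a fin_num.
Proof.
move=> s0; rewrite ge0_fin_numE ?tail_ge0//.
by rewrite (le_lt_trans (tail_le1 s0)) ?ltry.
Qed.

(** Equality would force [f t = 0], and a non-increasing density that vanishes
    at [t] has no mass beyond [t]. *)
Lemma tail_decreasing s t : 0 <= s -> s < t -> (0 < tail f t)%E ->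
  (tail f t < tail f s)%E.
Proof.
move=> s0 st Ft; have t0 : 0 <= t by lra.
have [_ _ fni _] := fd.
have ft : 0 < f t.
  rewrite lt_neqAle density_ge0// andbT eq_sym; apply/eqP => ft0.
  move: Ft; rewrite /tail integral0_eq ?ltxx// => x /=; rewrite in_itv /= andbT => tx.
  congr EFin; apply/eqP; rewrite eq_le density_ge0 ?(le_trans t0)// -ft0.
  by rewrite fni.
rewrite (tail_split s0 (ltW st)) lteDr ?tail_fin//.
apply: (@lt_le_trans _ _ (\int[mu]_(x in `[s, t[) (cst (f t)%:E) x)%E).
  rewrite integral_cst//= lebesgue_measure_itv /= lte_fin st -EFinB -EFinM lte_fin.
  by apply: mulr_gt0 => //; lra.
apply: ge0_le_integral => //=.
- by move=> x _; rewrite lee_fin ltW.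
- by apply: density_measurable; exact: subset_half.
- move=> x; rewrite in_itv /= => /andP[sx xt].
  by rewrite lee_fin fni ?(le_trans s0)// ltW.
Qed.

(** Both [v + s] and [u] lie between [v] and [u + s], with complementary convex
    weights; multiply the two log-concavity inequalities. *)
Lemma log_concave_exchange v u s : log_concave f -> 0 <= v -> v <= u -> 0 <= s ->
  f v * f (u + s) <= f (v + s) * f u.
Proof.
move=> lc v0 vu s0.
have fv0 := density_ge0 v0; have fc0 : 0 <= f (u + s) by apply: density_ge0; lra.
have [fvc0|fvc] := eqVneq (f v * f (u + s)) 0.
  by rewrite fvc0 mulr_ge0//; apply: density_ge0; lra.
have [s_eq0|s_neq0] := eqVneq s 0.
  by rewrite s_eq0 !addr0.
have s_gt0 : 0 < s by rewrite lt_neqAle eq_sym s_neq0.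
have cv_gt0 : 0 < u + s - v by lra.
(* v + s has weights 1 - th, th on v, u + s, and u has weights th, 1 - th *)
pose th := s / (u + s - v).
have th0 : 0 <= th by rewrite divr_ge0 // ltW.
have th1 : th <= 1 by rewrite ler_pdivrMr// mul1r; lra.
have c0 : 0 <= u + s by lra.
have cv : u + s - v != 0 by rewrite gt_eqF.
have e1 : v + s = (1 - th) * v + th * (u + s) by rewrite /th; field.
have e2 : u = (1 - (1 - th)) * v + (1 - th) * (u + s) by rewrite /th; field.
have l1 := lc v (u + s) th v0 c0 th0 th1.
have l2 : f v `^ (1 - (1 - th)) * f (u + s) `^ (1 - th) <= f u.
  by rewrite {2}e2; apply: lc => //; lra.
rewrite {1}e1; apply: le_trans (ler_pM _ _ l1 l2); rewrite ?mulr_ge0 ?powR_ge0//.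
rewrite mulrACA -!powRD; last 2 first.
- by apply/implyP => _; move: fvc; rewrite mulf_eq0 negb_or => /andP[].
- by apply/implyP => _; move: fvc; rewrite mulf_eq0 negb_or => /andP[].
have -> : 1 - th + (1 - (1 - th)) = 1 by ring.
have -> : th + (1 - th) = 1 by ring.
by rewrite !powRr1.
Qed.

(** The law with density [f] is new better than used.  Split [0, +oo[ at [t]
    into masses [a], [b], and split the shifted density into masses [a'], [b'];
    integrating the exchange inequality over the two pieces gives
    [b' * a <= a' * b], and [a + b = 1] turns this into
    [b' <= (a' + b') * b]. *)
Lemma tail_submultiplicative s t : log_concave f -> 0 <= s -> 0 <= t ->
  (tail f (s + t) <= tail f s * tail f t)%E.
Proof.
move=> lc s0 t0.
have st0 : 0 <= t + s by lra.
have cf a : 0 <= a -> {within `[a, +oo[, continuous f}.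
  move=> a0; case: fd => _ + _ _; apply: continuous_subspaceW; exact: subset_half.
have fge0 x : 0 <= x -> (0 <= (f x)%:E)%E by move=> x0; rewrite lee_fin density_ge0.
have shf a : 0 <= a -> tail f (a + s) = (\int[mu]_(x in `[a, +oo[) (f (x + s))%:E)%E.
  move=> a0; apply: integral_shift => [|x ax]; first by apply: cf; lra.
  by apply: density_ge0; lra.
have mfs (i : interval R) : [set` i] `<=` `[0, +oo[ ->
    measurable_fun [set` i] (fun x => (f (x + s))%:E).
  move=> sub; apply: (measurable_funS _ sub) => //.
  have sub' : (fun x : R => x + s) @` (`[(0 : R), +oo[ : set R) `<=`
      (`[(0 : R), +oo[ : set R).
    move=> _ [x /= + <-]; rewrite !in_itv /= !andbT => x0; exact: addr_ge0.
  have mf := @density_measurable (`[0%R, +oo[)%R (@subset_refl _ _).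
  apply: (measurable_comp _ sub' mf) => //.
  by apply: measurable_funD => //; exact: measurable_id.
set a := (\int[mu]_(x in `[0%R, t[) (f x)%:E)%E.
set a' := (\int[mu]_(x in `[0%R, t[) (f (x + s))%:E)%E.
have a0 : (0 <= a)%E.
  by apply: integral_ge0 => x /=; rewrite in_itv/= => /andP[x0 _]; exact: fge0.
have a'0 : (0 <= a')%E.
  by apply: integral_ge0 => x /=; rewrite in_itv/= => /andP[x0 _]; apply: fge0; lra.
have e1 : (a + tail f t = 1)%E by rewrite -tail0 (tail_split (lexx 0) t0).
have e2 : (tail f s = a' + tail f (t + s))%E.
  rewrite -{1}[s]add0r shf// shf// /a' -ge0_integral_setU //.
  - by rewrite -itv_bndbnd_setU // bnd_simp.
  - by rewrite -itv_bndbnd_setU ?bnd_simp//; apply: mfs; exact: subset_half.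
  - rewrite -itv_bndbnd_setU ?bnd_simp//= => x; rewrite in_itv /= andbT => sx.
    by apply: fge0; lra.
  - apply/disj_setPS => x [] /=; rewrite !in_itv /= andbT => /andP[_ xt] tx.
    by have := lt_le_trans xt tx; rewrite ltxx.
have key : (tail f (t + s) * a <= a' * tail f t)%E.
  rewrite shf// -ge0_integralZr//=; last 2 first.
  - by apply: mfs; exact: subset_half.
  - by move=> x; rewrite in_itv/= andbT => tx; apply: fge0; lra.
  rewrite muleC /tail -ge0_integralZr//=; last 2 first.
  - by apply: density_measurable; exact: subset_half.
  - by move=> x; rewrite in_itv/= andbT => tx; apply: fge0; lra.
  apply: ge0_le_integral => //=.
  - by move=> x; rewrite in_itv/= andbT => tx; apply: mule_ge0 => //; apply: fge0; lra.
  - by apply: emeasurable_funM => //; apply: mfs; exact: subset_half.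
  - by apply: emeasurable_funM => //; apply: density_measurable; exact: subset_half.
  move=> u; rewrite in_itv/= andbT => tu.
  rewrite /a /a' -ge0_integralZl//=; last 3 first.
  - by apply: density_measurable; exact: subset_half.
  - by move=> x; rewrite in_itv/= => /andP[x0 _]; apply: fge0.
  - by apply: fge0; lra.
  rewrite -ge0_integralZl//=; last 3 first.
  - by apply: mfs; exact: subset_half.
  - by move=> x; rewrite in_itv/= => /andP[x0 _]; apply: fge0; lra.
  - by apply: fge0; lra.
  apply: ge0_le_integral => //=.
  - by move=> x; rewrite in_itv/= => /andP[x0 _]; apply: mule_ge0; apply: fge0; lra.
  - by apply: emeasurable_funM => //; apply: density_measurable; exact: subset_half.
  - by apply: emeasurable_funM => //; apply: mfs; exact: subset_half.
  move=> v; rewrite in_itv/= => /andP[v0 vt]; rewrite -!EFinM lee_fin.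
  rewrite mulrC [X in _ <= X]mulrC; apply: log_concave_exchange => //; lra.
rewrite [s + t]addrC e2 ge0_muleDl ?tail_ge0//.
rewrite -[leLHS]mule1 -e1 ge0_muleDr ?tail_ge0//.
by rewrite leeD2r.
Qed.
End Tail.

(** * Chaining functionals *)

(** A chaining functional enters the rest of the proof only through these four
    properties. *)
Record chaining_profile (R : realType) (h : R -> R) : Prop := ChainingProfile {
  profile1 : h 1 = 0;
  profile_antitone : forall p q, 0 < p -> p <= q -> q <= 1 -> h q <= h p;
  profile_mul : forall p q, 0 < p -> p <= 1 -> 0 < q -> q <= 1 ->
    h (p * q) <= h p + h q;
  profile_le_ln : forall p, 0 < p -> p <= 1 -> h p <= - ln p }.

Section Functional.
Local Open Scope classical_set_scope.
Variable R : realType.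
Variables f h : R -> R.
Implicit Types (a s t u v x p q : R).
Hypothesis fh : chaining_functional f h.

Let fd : chaining_density f. Proof. by case: fh. Qed.

Lemma functional_ge0 p : 0 < p -> p <= 1 -> 0 <= h p.
Proof. by case: fh => _ H p0 p1; case: (H p p0 p1). Qed.

Lemma tail_functional p : 0 < p -> p <= 1 -> tail f (h p) = p%:E.
Proof. by case: fh => _ H p0 p1; case: (H p p0 p1). Qed.

(** [h p] is the only point where the tail takes the value [p], by strict
    monotonicity; this is how every statement about [h] is deduced from one
    about the tail. *)
Lemma functional_lower p s : 0 < p -> p <= 1 -> 0 <= s ->
  (tail f s <= p%:E)%E -> h p <= s.
Proof.
move=> p0 p1 s0 Fs; rewrite leNgt; apply/negP => sh.
have := @tail_decreasing R f fd s (h p) s0 sh.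
by rewrite tail_functional// lte_fin => /(_ p0); rewrite ltNge Fs.
Qed.

Lemma functional1 : h 1 = 0.
Proof.
apply/eqP; rewrite eq_le functional_ge0//= andbT.
by apply: functional_lower => //; rewrite tail0.
Qed.

Lemma functional_antitone p q : 0 < p -> p <= q -> q <= 1 -> h q <= h p.
Proof.
move=> p0 pq q1; have p1 : p <= 1 by lra. have q0 : 0 < q by lra.
by apply: functional_lower; rewrite ?functional_ge0// tail_functional// lee_fin.
Qed.

Lemma functional_mul p q : log_concave f -> 0 < p -> p <= 1 -> 0 < q -> q <= 1 ->
  h (p * q) <= h p + h q.
Proof.
move=> lc p0 p1 q0 q1.
have hp0 := functional_ge0 p0 p1; have hq0 := functional_ge0 q0 q1.
apply: functional_lower; [exact: mulr_gt0| |exact: addr_ge0|].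
  by rewrite mulr_ile1// ltW.
by rewrite EFinM -!tail_functional//; exact: tail_submultiplicative.
Qed.

(** By submultiplicativity [h p <= n * h q] with [q ^+ n = p].  For large n the
    point [q] is close to 1, where the slope of [h] is 1 in absolute value, and
    [1 - q <= - ln p / n]. *)
Lemma functional_le_ln p : log_concave f -> normalized h ->
  0 < p -> p <= 1 -> h p <= - ln p.
Proof.
move=> lc [l hl l1] p0 p1.
have [p_eq1|p_neq1] := eqVneq p 1; first by rewrite p_eq1 functional1 ln1 oppr0.
have lnp : ln p < 0 by rewrite ln_lt0// p0 lt_neqAle p_neq1.
have hpow n q : 0 < q -> q <= 1 -> h (q ^+ n) <= h q *+ n.
  move=> q0 q1; elim: n => [|n IH]; first by rewrite expr0 functional1 mulr0n.
  rewrite exprS mulrS; apply: (le_trans (functional_mul lc q0 q1 _ _)).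
  - by rewrite exprn_gt0.
  - by rewrite exprn_ile1// ltW.
  - by rewrite lerD2l.
have near_slope e : 0 < e -> exists2 dl : R, 0 < dl &
    forall t, t < 0 -> - dl < t -> h (1 + t) <= (1 + e) * - t.
  move=> e0; move/cvgrPdist_lt : hl => /(_ _ e0) [dl /= dl0 H].
  exists (Num.min dl 1) => [|t t0]; first by rewrite lt_min dl0 ltr01.
  rewrite ltrNl lt_min => /andP[tdl t1].
  have := H t; rewrite /ball_ /= sub0r normrN ltr0_norm// => /(_ tdl t0).
  rewrite functional1 subr0 => lt_e.
  have : `|h (1 + t) / t| < 1 + e.
    rewrite -[X in _ < X + _]l1; apply: (@le_lt_trans _ _ (`|l| + `|l - h (1 + t) / t|)).
      by have := ler_normB l (l - h (1 + t) / t); rewrite subKr.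
    by rewrite ltrD2l.
  rewrite normf_div (ltr0_norm t0) ltr_pdivrMr ?oppr_gt0// => /ltW; apply: le_trans.
  exact: ler_norm.
apply/ler_addgt0Pr => e e0.
have lnp' : 0 < - ln p by rewrite oppr_gt0.
have [dl dl0 H] := near_slope _ (divr_gt0 e0 lnp').
(* n is large enough for the n-th root of p to lie within dl of 1 *)
pose n := (Num.truncn (- ln p / dl)).+1.
have n0 : 0 < n%:R :> R by rewrite ltr0n.
have nlt : - ln p / n%:R < dl.
  by rewrite ltr_pdivrMr// mulrC -ltr_pdivrMr// truncnS_gt.
pose q := expR (ln p / n%:R).
have q_ge : 1 + ln p / n%:R <= q by exact: expR_ge1Dx.
have q_lt1 : q < 1 by rewrite expR_lt1 pmulr_llt0// invr_gt0.
have qn : q ^+ n = p.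
  by rewrite /q -expRM_natl mulrC divfK ?gt_eqF// lnK.
have := hpow n q (expR_gt0 _) (ltW q_lt1); rewrite qn => /le_trans; apply.
have Hq := H (q - 1).
have q1q : 1 + (q - 1) = q by rewrite addrC subrK.
have {}Hq : h q <= (1 + e / - ln p) * (- ln p / n%:R).
  rewrite -q1q; apply: le_trans (Hq _ _) _; [by rewrite subr_lt0|move: nlt; lra|].
  rewrite ler_pM2l; first by lra.
  by rewrite addr_gt0// divr_gt0.
rewrite -mulr_natr; apply: le_trans (ler_wpM2r (ltW n0) Hq) _.
rewrite -mulrA divfK ?gt_eqF// mulrDl mul1r divfK ?gt_eqF//.
Qed.

Lemma chaining_profileP : log_concave f -> normalized h -> chaining_profile h.
Proof.
move=> lc nh; split.
- exact: functional1.
- exact: functional_antitone.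
- by move=> p q; exact: functional_mul.
- by move=> p; exact: functional_le_ln.
Qed.
End Functional.

Section Profile.
Local Open Scope classical_set_scope.
Variables (R : realType) (h : R -> R).
Implicit Types (p q : R).
Hypothesis hp : chaining_profile h.

Lemma chaining_ext_pos p : 0 < p -> chaining_ext h p = (h p)%:E.
Proof. by rewrite /chaining_ext => ->. Qed.

(** The value at 0 is the limit, hence the supremum, of the values on ]0, 1]. *)
Lemma chaining_ext_le0 p q : p <= 0 -> 0 < q -> q <= 1 ->
  (chaining_ext h q <= chaining_ext h p)%E.
Proof.
move=> p0 q0 q1; rewrite chaining_ext_pos// /chaining_ext ltNge p0 /=.
have := @nonincreasing_at_right_cvge R (fun q => (h q)%:E) 0 (BRight 1).
rewrite bnd_simp => /(_ ltr01) cv.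
rewrite (cvg_lim _ (cv _))//; first by apply: ereal_sup_ubound;
  exists q => //=; rewrite in_itv/= q0.
move=> x y; rewrite !in_itv/= => /andP[x0 x1] /andP[y0 y1] xy.
by rewrite lee_fin; apply: (profile_antitone hp).
Qed.

Lemma chaining_ext_antitone p q : p <= q -> q <= 1 ->
  0 < q -> (chaining_ext h q <= chaining_ext h p)%E.
Proof.
move=> pq q1 q0; have [p0|p0] := leP p 0; first exact: chaining_ext_le0.
by rewrite !chaining_ext_pos// lee_fin; apply: (profile_antitone hp).
Qed.

Lemma chaining_ext_ge0 p : p <= 1 -> (0 <= chaining_ext h p)%E.
Proof.
move=> p1; rewrite -[0%E]/(0%:E) -(profile1 hp) -chaining_ext_pos//.
exact: chaining_ext_antitone.
Qed.

Lemma chaining_ext1 : chaining_ext h 1 = 0%E.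
Proof. by rewrite chaining_ext_pos// (profile1 hp). Qed.

(** If [p < q], then [h p <= h q + h (p / q)] and
    [h (p / q) <= ln (q / p) <= (q / p) / e]; the last step is
    [ln y + 1 <= y] at [y = (q / p) / e]. *)
Lemma profile_le_ratio p q : 0 < p -> p <= 1 -> 0 <= q -> q <= 1 ->
  (chaining_ext h p <= chaining_ext h q + (q / p / expR 1)%:E)%E.
Proof.
move=> p0 p1 q_ge0 q1; have [q0|q0] := leP q 0.
  apply: le_trans (chaining_ext_le0 q0 p0 p1) _; rewrite leeDl// lee_fin.
  by rewrite divr_ge0 ?expR_ge0// divr_ge0// ltW.
have [pq|qp] := leP q p.
  apply: le_trans (chaining_ext_antitone pq p1 p0) _; rewrite leeDl// lee_fin.
  by rewrite ltW// !divr_gt0// expR_gt0.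
rewrite !chaining_ext_pos// -EFinD lee_fin.
have pq0 : 0 < p / q by rewrite divr_gt0.
have pq1 : p / q <= 1 by rewrite ler_pdivrMr// mul1r ltW.
rewrite {1}(_ : p = q * (p / q)); last by rewrite mulrC divfK// gt_eqF.
apply: le_trans (profile_mul hp q0 q1 pq0 pq1) _.
rewrite lerD2l; apply: le_trans (profile_le_ln hp pq0 pq1) _.
rewrite -lnV ?posrE// invf_div.
have x0 : 0 < q / p / expR 1 by rewrite !divr_gt0// expR_gt0.
have -> : q / p = q / p / expR 1 * expR 1 by rewrite divfK// gt_eqF// expR_gt0.
rewrite lnM ?posrE ?expR_gt0// expRK.
have := @le_ln1Dx _ (q / p / expR 1 - 1).
rewrite (_ : 1 + (_ - 1) = q / p / expR 1); last by rewrite addrC subrK.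
by rewrite mulfK ?gt_eqF ?expR_gt0// => le_ln; have := le_ln _; lra.
Qed.
End Profile.

(** * Chaining integrals as finite sums *)

Section Steps.
Local Open Scope classical_set_scope.
Variables (R : realType) (X : finType).
Implicit Types (d : X -> X -> R) (x y z : X) (r D : R).

(** The points are ordered by their distance to [x], ties being broken by their
    rank, so that every radius has a unique last point in its ball. *)
Definition farther d x y z : bool :=
  (d x y < d x z) || ((d x y == d x z) && (enum_rank y < enum_rank z)%N).

(** The distance from [x] to the successor of [y] in this order, or [D] if [y]
    is the last point.  Among tied points only the last one can have a positive
    gap [next_dist - d x y]. *)
Definition next_dist d D x y : R := \big[Num.min/D]_(z | farther d x y z) d x z.

Lemma next_dist_le d D x y : next_dist d D x y <= D.
Proof. exact: bigmin_le_id. Qed.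

Lemma next_dist_ge d D x y : d x y <= D -> d x y <= next_dist d D x y.
Proof.
move=> dD; apply/bigmin_geP; split=> // z /orP[/ltW//|/andP[/eqP-> _]//].
Qed.

Lemma next_distE d D x y (v : R) :
  v <= D -> (forall z, farther d x y z -> v <= d x z) ->
  v = D \/ (exists2 z, farther d x y z & v = d x z) ->
  v = next_dist d D x y.
Proof.
move=> vD vz vE; apply/eqP; rewrite eq_le; apply/andP; split.
  by apply/bigmin_geP; split.
case: vE => [->|[z xyz ->]]; first exact: next_dist_le.
exact: bigmin_le_cond.
Qed.

Lemma last_point d x r : d x x = 0 -> 0 <= r ->
  exists y, [/\ d x y <= r, forall z, d x z <= r -> d x z <= d x y &
    forall z, farther d x y z -> r < d x z].
Proof.
move=> dxx r0.
have xr : d x x <= r by rewrite dxx.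
(* among the points of the ball at maximal distance, take the last in rank *)
have [y1 y1r y1max] := @arg_maxP _ _ _ x (fun z => d x z <= r) (d x) xr.
have y1E : d x y1 == d x y1 by [].
have [y /eqP yE ymax] := @arg_maxnP _ y1 (fun z => d x z == d x y1)
  (fun z => enum_rank z : nat) y1E.
exists y; rewrite yE; split=> //.
move=> z /orP[lt|/andP[/eqP E lt]]; rewrite ltNge; apply/negP => zr.
  by have := y1max z zr; rewrite /= leNgt -yE lt.
have := ymax z; rewrite /= -E yE eqxx => /(_ isT).
by rewrite leqNgt lt.
Qed.

(** As a function of the radius, the ball around [x] is constant on each
    interval [[d x y, next_dist y[], and these intervals partition [[0, D[].
    Beyond [D] the ball is everything, so there either [g] must vanish at the
    whole space or [r] must be excluded. *)
Lemma ball_steps d D x r (g : {set X} -> \bar R) :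
  d x x = 0 -> (forall y, d x y <= D) -> 0 <= r ->
  r < D \/ g [set: X]%SET = 0%E ->
  g (cball d x r) =
  (\sum_y (\1_(`[d x y, next_dist d D x y[) r)%:E * g (cball d x (d x y)))%E.
Proof.
move=> dxx dD r0 rg.
have [rD|Dr] := ltP r D; last first.
  have -> : cball d x r = [set: X]%SET.
    by apply/setP => y; rewrite !inE (le_trans (dD y)).
  case: rg => [|->]; first by rewrite ltNge Dr.
  rewrite big1// => y _; rewrite indicE memNset ?mul0e//= in_itv/=.
  by move=> /andP[_]; rewrite ltNge (le_trans (next_dist_le _ _ _ _) Dr).
have [y [yr ymax ylast]] := last_point dxx r0.
rewrite (bigD1 y)//= big1 ?adde0.
  rewrite indicE mem_set/= ?mul1e.
    congr g; apply/setP => z; rewrite !inE; apply/idP/idP; first exact: ymax.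
    by move=> /le_trans; apply.
  rewrite in_itv/= yr; apply/bigmin_gtP; split => // z; exact: ylast.
move=> z zy; rewrite indicE memNset ?mul0e//= in_itv/= => /andP[zr rz].
have nzy : ~~ farther d x z y.
  apply/negP => H; have : next_dist d D x z <= d x y by exact: bigmin_le_cond.
  by rewrite leNgt (le_lt_trans yr rz).
have nyz : ~~ farther d x y z.
  by apply/negP => /ylast; rewrite ltNge zr.
move: nzy nyz; rewrite /farther !negb_or -!leNgt => /andP[yz a] /andP[zy' b].
have E : d x z = d x y by apply/eqP; rewrite eq_le yz zy'.
move: a b; rewrite E eqxx /= -!leqNgt => a b.
move/eqP: zy; apply; apply: enum_rank_inj; apply: val_inj; apply/eqP.
by rewrite eqn_leq a b.
Qed.

Lemma measurable_ball_steps d D x (E : set R) (g : {set X} -> \bar R) :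
  measurable E ->
  d x x = 0 -> (forall y, d x y <= D) -> E `<=` `[0%R, +oo[ ->
  (forall r, E r -> r < D) \/ g [set: X]%SET = 0%E ->
  measurable_fun E (fun r : R => g (cball d x r)).
Proof.
move=> mE dxx dD E0 Eg.
apply: (@eq_measurable_fun _ _ _ _ E (fun r : R =>
  (\sum_y (\1_(`[d x y, next_dist d D x y[ : set R) r)%:E * g (cball d x (d x y)))%E)).
  move=> r /[!inE] Er; apply/esym; apply: ball_steps => //.
    by have := E0 _ Er; rewrite /= in_itv/= andbT.
  by case: Eg => [/(_ r Er)|]; [left|right].
apply: emeasurable_sum => y.
apply: emeasurable_funM; last exact: measurable_cst.
by apply/measurable_EFinP; exact: measurable_indic.
Qed.

(** Used with [E = [0, +oo[] for the chaining integral, where [g] vanishes at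
    the whole space because [h 1 = 0], and with [E = [0, D[] and [g = 1] to sum
    the gaps. *)
Lemma integral_ball_steps d D x (E : set R) (g : {set X} -> \bar R) :
  measurable E ->
  (forall y, 0 <= d x y) -> d x x = 0 -> (forall y, d x y <= D) ->
  `[0%R, D[ `<=` E -> E `<=` `[0%R, +oo[ ->
  (forall r, E r -> r < D) \/ g [set: X]%SET = 0%E ->
  (forall A, 0 <= g A)%E ->
  (\int[@lebesgue_measure R]_(r in E) g (cball d x r) =
   \sum_y (next_dist d D x y - d x y)%:E * g (cball d x (d x y)))%E.
Proof.
move=> mE d0 dxx dD DE E0 Eg g0.
transitivity (\int[@lebesgue_measure R]_(r in E)
  (\sum_y (\1_(`[d x y, next_dist d D x y[ : set R) r)%:E * g (cball d x (d x y))))%E.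
  apply: eq_integral => r /[!inE] Er; apply: ball_steps => //.
    by have := E0 _ Er; rewrite /= in_itv/= andbT.
  by case: Eg => [/(_ r Er)|]; [left|right].
rewrite ge0_integral_sum//; last 2 first.
- move=> y; apply: emeasurable_funM; last exact: measurable_cst.
  by apply/measurable_EFinP; exact: measurable_indic.
- by move=> y r _; apply: mule_ge0; rewrite ?lee_fin.
apply: eq_bigr => y _; rewrite ge0_integralZr//; last first.
  by apply/measurable_EFinP; exact: measurable_indic.
rewrite integral_indic// setIidl; last first.
  apply: subset_trans DE => r /=; rewrite !in_itv/= => /andP[r0 rn].
  by rewrite (le_trans (d0 y) r0) (lt_le_trans rn)//; exact: next_dist_le.
congr (_ * _)%E; rewrite /= lebesgue_measure_itv/= lte_fin.
have := next_dist_ge (dD y); rewrite le_eqVlt => /orP[/eqP <-|->].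
  by rewrite ltxx subrr.
by rewrite EFinB.
Qed.

Lemma sum_gaps d D x : (forall y, 0 <= d x y) -> d x x = 0 ->
  (forall y, d x y <= D) -> \sum_y (next_dist d D x y - d x y) = D.
Proof.
move=> d0 dxx dD.
have D0 : 0 <= D by rewrite (le_trans (d0 x)).
have mD : lebesgue_measure (`[0%R, D[ : set R) = D%:E.
  rewrite lebesgue_measure_itv/= lte_fin oppr0 adde0.
  by move: D0; rewrite le_eqVlt => /orP[/eqP <-|->]; rewrite ?ltxx.
have := @integral_ball_steps d D x `[0%R, D[ (fun=> 1%E) _ d0 dxx dD.
rewrite integral_cst// mul1e /= mD => H; apply/EFin_inj; rewrite H//.
- by rewrite -sumEFin; apply: eq_bigr => y _; rewrite mule1.
- by move=> r /=; rewrite !in_itv/= => /andP[->].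
- by left => r /=; rewrite in_itv/= => /andP[_].
Qed.
End Steps.

(** * The self-average against an arbitrary measure *)

Section FiniteMeasures.
Variables (R : realType) (X : finType).
Implicit Types (nu mu : X -> R) (A B S : {set X}) (x y : X).

Lemma meas_ge0 nu A : (forall x, 0 <= nu x) -> 0 <= meas nu A.
Proof. by move=> nu0; apply: sumr_ge0. Qed.

Lemma meas_subset nu A B : (forall x, 0 <= nu x) -> A \subset B ->
  meas nu A <= meas nu B.
Proof.
move=> nu0 AB; rewrite /meas [leRHS](big_setID A)/= (finset.setIidPr AB).
by rewrite lerDl sumr_ge0.
Qed.

Lemma measT nu : is_prob nu -> meas nu [set: X]%SET = 1.
Proof. by case=> _ <-; apply: eq_bigl => x; rewrite inE. Qed.

Lemma meas_le1 nu A : is_prob nu -> meas nu A <= 1.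
Proof. by move=> np; rewrite -(measT np) meas_subset ?finset.subsetT//; case: np. Qed.

Lemma le_meas nu A x : (forall x, 0 <= nu x) -> x \in A -> nu x <= meas nu A.
Proof. by move=> nu0 xA; rewrite /meas (bigD1 x)//= lerDl sumr_ge0. Qed.

Lemma meas_setU1 nu S x : x \in S -> meas nu S = nu x + meas nu (S :\ x).
Proof. by move=> xS; rewrite /meas (big_setD1 x). Qed.

Lemma measI_restrict nu S A :
  meas (fun x => if x \in S then nu x else 0) A = meas nu (A :&: S).
Proof. by rewrite /meas -big_mkcondr; apply: eq_bigl => x; rewrite inE. Qed.

End FiniteMeasures.

Section Halving.
Variables (R : realType) (X : finType).
Variables (d : X -> X -> R).
Implicit Types (mu nu : X -> R) (x y z : X) (r : R).
Hypothesis dm : is_metric d.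

Lemma metric_ge0 x y : 0 <= d x y. Proof. by case: dm. Qed.
Lemma metricxx x : d x x = 0. Proof. by case: dm => _ H _ _; apply/H. Qed.
Lemma metricC x y : d x y = d y x. Proof. by case: dm. Qed.

Lemma le_diam x y : d x y <= diam d.
Proof.
apply: le_trans (le_bigmax 0 (d x) y) _.
exact: (le_bigmax 0 (fun x => \big[Num.max/0]_v d x v) x).
Qed.

Lemma diam_ge0 : 0 <= diam d.
Proof. exact: bigmax_ge_id. Qed.

Variable h : R -> R.
Hypothesis hp : chaining_profile h.

Lemma chain_int_steps (m : {set X} -> R) (D : R) x :
  (forall y, d x y <= D) -> m [set: X]%SET = 1 -> (forall A, m A <= 1) ->
  chain_int h d m x = (\sum_y (next_dist d D x y - d x y)%:E *
                        chaining_ext h (m (cball d x (d x y))))%E.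
Proof.
move=> dD mT m1.
apply: (@integral_ball_steps _ _ d D x _ (fun A => chaining_ext h (m A))) => //.
- exact: metric_ge0.
- exact: metricxx.
- by move=> r /=; rewrite !in_itv/= => /andP[->].
- by right; rewrite mT chaining_ext1.
- by move=> A; rewrite chaining_ext_ge0.
Qed.
End Halving.

Section Upper.
Local Open Scope classical_set_scope.
Variables (R : realType) (X : finType).
Variables (d : X -> X -> R) (h : R -> R).
Implicit Types (mu nu : X -> R) (x y z : X) (r : R).
Hypothesis dm : is_metric d.
Hypothesis hp : chaining_profile h.

Let d2 x y := d x y / 2.

Lemma half_metric : is_metric d2.
Proof.
case: dm => d0 dE dC dtri; split=> [x y|x y|x y|x y z].
- by rewrite divr_ge0.
- rewrite -dE /d2; split=> [|->]; last by rewrite mul0r.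
  by move/eqP; rewrite mulf_eq0 invr_eq0 pnatr_eq0 orbF => /eqP.
- by rewrite /d2 dC.
- by rewrite /d2 -mulrDl ler_pM2r ?invr_gt0.
Qed.

Lemma half_next_dist D x y : next_dist d2 (D / 2) x y = next_dist d D x y / 2.
Proof.
have far z : farther d2 x y z = farther d x y z.
  rewrite /farther /d2 ltr_pM2r ?invr_gt0//.
  by rewrite (inj_eq (mulIf _))// invr_eq0 pnatr_eq0.
rewrite /next_dist (big_morph (fun t => t / 2) (id1 := D / 2) (op1 := Num.min)) //.
  by apply: eq_bigl.
by move=> u v; rewrite minr_pMl// invr_ge0.
Qed.

(** Halving the metric halves all the gaps and keeps all the balls: this is the
    change of variables [r = 2 r'], made on the finite sums. *)
Lemma half_chain_int (m : {set X} -> R) x :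
  m [set: X]%SET = 1 -> (forall A, m A <= 1) ->
  (chain_int h d m x = 2%:E * chain_int h d2 m x)%E.
Proof.
move=> mT m1.
rewrite (chain_int_steps dm hp (le_diam d x) mT m1).
have dD2 y : d2 x y <= diam d / 2 by rewrite ler_pM2r ?invr_gt0// le_diam.
rewrite (chain_int_steps half_metric hp dD2 mT m1).
rewrite ge0_sume_distrr; last first.
  move=> y _; apply: mule_ge0; last exact: chaining_ext_ge0.
  by rewrite lee_fin subr_ge0 next_dist_ge.
apply: eq_bigr => y _; rewrite muleA -EFinM half_next_dist /d2 -mulrBl mulrC divfK//.
congr (_ * chaining_ext h (m _))%E; apply/setP => z; rewrite !inE.
by rewrite ler_pM2r ?invr_gt0.
Qed.

(** Exchange the sums and write the left-hand side as an average over [y] under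
    [mu] of [\sum_(x in B y r) nu x / nu (B x (2 r))].  The triangle inequality
    bounds the denominator below by [nu (B y r)], and the inner sum by 1. *)
Lemma sum_ratio_le1 mu nu r : is_prob mu -> (forall x, 0 <= nu x) ->
  \sum_x nu x * (meas mu (cball d x r) / meas nu (cball d2 x r)) <= 1.
Proof.
move=> [mu0 mu1] nu0.
pose a x := meas nu (cball d2 x r).
have a0 x : 0 <= a x by exact: meas_ge0.
have -> : \sum_x nu x * (meas mu (cball d x r) / a x) =
    \sum_y mu y * \sum_(x in cball d y r) nu x / a x.
  under eq_bigr do rewrite mulrCA mulr_suml big_mkcond/=.
  rewrite exchange_big/=; apply: eq_bigr => y _.
  rewrite mulr_sumr big_mkcond [RHS]big_mkcond/=; apply: eq_bigr => x _.
  by rewrite !inE metricC//; case: ifP.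
rewrite -mu1; apply: ler_sum => y _.
rewrite -[leRHS]mulr1; apply: ler_wpM2l => //.
have [b0|b0] := eqVneq (meas nu (cball d y r)) 0.
  rewrite big1// => x xy; suff -> : nu x = 0 by rewrite mul0r.
  by apply/eqP; rewrite eq_le nu0 -b0 le_meas.
rewrite -(divff b0) {1}/meas mulr_suml; apply: ler_sum => x xy.
have le_a : meas nu (cball d y r) <= a x.
  apply: meas_subset => //; apply/fintype.subsetP => z; rewrite !inE => yz.
  rewrite /d2 ler_pdivrMr// mulr_natr mulr2n.
  case: dm => _ _ _ dtri; apply: le_trans (dtri x y z) _.
  by apply: lerD => //; move: xy; rewrite inE metricC.
have b_gt0 : 0 < meas nu (cball d y r) by rewrite lt_neqAle eq_sym b0 meas_ge0.
by apply: ler_wpM2l => //; rewrite lef_pV2 ?posrE// (lt_le_trans b_gt0).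
Qed.

(** Apply [profile_le_ratio] to [nu (B x (2 r))] and [mu (B x r)], and average
    over [x] under [nu]. *)
Lemma ball_exchange mu nu r : 0 <= r -> is_prob mu -> is_prob nu ->
  (\sum_x (nu x)%:E * chaining_ext h (meas nu (cball d2 x r)) <=
   \sum_x (nu x)%:E * chaining_ext h (meas mu (cball d x r)) + (expR 1)^-1%:E)%E.
Proof.
move=> r0 mup nup; have [nu0 _] := nup; have [mu0 _] := mup.
have e0 : 0 < (expR 1)^-1 :> R by rewrite invr_gt0 expR_gt0.
pose q x := meas mu (cball d x r) / meas nu (cball d2 x r).
apply: (@le_trans _ _ (\sum_x ((nu x)%:E * chaining_ext h (meas mu (cball d x r)) +
    (nu x * q x * (expR 1)^-1)%:E))%E).
  apply: lee_sum => x _.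
  have [nux0|nux0] := eqVneq (nu x) 0; first by rewrite nux0 !mul0r !mul0e adde0.
  have nux : 0 < nu x by rewrite lt_neqAle eq_sym nux0 nu0.
  have xx : x \in cball d2 x r by rewrite inE /d2 metricxx// mul0r.
  have a0 := lt_le_trans nux (le_meas nu0 xx).
  have := profile_le_ratio hp a0 (meas_le1 _ nup) (meas_ge0 (cball d x r) mu0)
    (meas_le1 (cball d x r) mup).
  move/(@lee_wpmul2l _ (nu x)%:E); rewrite lee_fin => /(_ (nu0 x))/le_trans; apply.
  rewrite ge0_muleDr//.
  - by rewrite -EFinM /q !mulrA.
  - by rewrite chaining_ext_ge0// meas_le1.
  - by rewrite lee_fin divr_ge0 ?expR_ge0// divr_ge0 ?meas_ge0.
rewrite big_split/= leeD2l// sumEFin lee_fin -mulr_suml.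
by rewrite ler_piMl ?(ltW e0)// sum_ratio_le1.
Qed.

(** Integrate [ball_exchange] over the radii below [diam / 2]; for larger radii
    the doubled ball is the whole space and the left-hand side vanishes. *)
Lemma half_avg_chain_int mu nu : is_prob mu -> is_prob nu ->
  (\sum_x (nu x)%:E * chain_int h d2 (meas nu) x <=
   avg_chain_int h d mu nu + (diam d / 2 / expR 1)%:E)%E.
Proof.
move=> mup nup; have [nu0 _] := nup.
have D0 : 0 <= diam d / 2 by rewrite divr_ge0// diam_ge0.
have dD2 x y : d2 x y <= diam d / 2 by rewrite ler_pM2r ?invr_gt0// le_diam.
have ext0 (m : X -> R) A : is_prob m -> (0 <= chaining_ext h (meas m A))%E.
  by move=> mp; rewrite chaining_ext_ge0// meas_le1.
have mext (dd : X -> X -> R) (D : R) (m : X -> R) x : is_metric dd ->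
    (forall y, dd x y <= D) -> is_prob m ->
    measurable_fun (`[0%R, +oo[ : set R)
      (fun r : R => chaining_ext h (meas m (cball dd x r))).
  move=> ddm ddD mp.
  apply: (@measurable_ball_steps _ _ dd D x _ (fun A => chaining_ext h (meas m A))) => //.
  - exact: metricxx.
  - by right; rewrite measT// chaining_ext1.
have intE (dd : X -> X -> R) (D : R) (m : X -> R) : is_metric dd ->
    (forall x y, dd x y <= D) -> is_prob m ->
    (\sum_x (nu x)%:E * chain_int h dd (meas m) x =
     \int[@lebesgue_measure R]_(r in `[0%R, +oo[)
       \sum_x (nu x)%:E * chaining_ext h (meas m (cball dd x r)))%E.
  move=> ddm ddD mp; rewrite ge0_integral_sum//.
  - apply: eq_bigr => x _; rewrite ge0_integralZl_EFin//.
      by move=> r _; exact: ext0.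
    exact: mext ddm (ddD x) mp.
  - by move=> x; apply: measurable_funeM; exact: mext ddm (ddD x) mp.
  - by move=> x r _; rewrite mule_ge0 ?lee_fin ?ext0.
rewrite /avg_chain_int (intE _ _ _ half_metric dD2 nup) (intE _ _ _ dm (le_diam d) mup).
pose g r : \bar R := ((expR 1)^-1%:E * (\1_(`[0%R, (diam d / 2)%R[ : set R) r)%:E)%E.
have mg : measurable_fun (`[0%R, +oo[ : set R) g.
  apply: measurable_funeM; apply/measurable_EFinP; exact: measurable_indic.
have -> : ((diam d / 2 / expR 1)%:E =
    \int[@lebesgue_measure R]_(r in `[0%R, +oo[) g r)%E.
  rewrite /g ge0_integralZl_EFin//; last first.
    by apply/measurable_EFinP; exact: measurable_indic.
  rewrite integral_indic//= setIidl; last first.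
    by move=> r /=; rewrite !in_itv/= => /andP[->].
  rewrite lebesgue_measure_itv/= lte_fin mulrC EFinM; congr (_ * _)%E.
  move: D0; rewrite le_eqVlt => /orP[/eqP <-|->]; first by rewrite ltxx.
  by rewrite oppr0 adde0.
have msum (dd : X -> X -> R) (D : R) (m : X -> R) : is_metric dd ->
    (forall x y, dd x y <= D) -> is_prob m ->
    measurable_fun (`[0%R, +oo[ : set R) (fun r : R =>
      \sum_x (nu x)%:E * chaining_ext h (meas m (cball dd x r)))%E.
  move=> ddm ddD mp; apply: emeasurable_sum => x; apply: measurable_funeM.
  exact: mext ddm (ddD x) mp.
have sum0 (dd : X -> X -> R) (m : X -> R) r : is_prob m ->
    (0 <= \sum_x (nu x)%:E * chaining_ext h (meas m (cball dd x r)))%E.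
  by move=> mp; apply: sume_ge0 => x _; rewrite mule_ge0 ?lee_fin ?ext0.
have g0 r : (0 <= g r)%E.
  by rewrite mule_ge0// lee_fin ?invr_ge0 ?expR_ge0.
rewrite -ge0_integralD//; last 2 first.
- by move=> r _; exact: sum0.
- exact: msum dm (le_diam d) mup.
apply: ge0_le_integral => //.
- by move=> r _; exact: sum0.
- exact: msum half_metric dD2 nup.
- apply: emeasurable_funD => //; exact: msum dm (le_diam d) mup.
move=> r; rewrite /= in_itv/= andbT => r0; rewrite /g.
have [rD|Dr] := ltP r (diam d / 2).
  rewrite indicE mem_set/= ?in_itv/= ?r0// mule1; exact: ball_exchange.
rewrite [leLHS]big1 ?adde_ge0 ?sum0 ?g0// => x _.
have -> : cball d2 x r = [set: X]%SET.
  by apply/setP => y; rewrite !inE (le_trans (dD2 x y)).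
by rewrite measT// chaining_ext1// mule0.
Qed.

Lemma self_avg_le mu nu : is_prob mu -> is_prob nu ->
  (avg_chain_int h d nu nu <=
   2%:E * avg_chain_int h d mu nu + (diam d / expR 1)%:E)%E.
Proof.
move=> mup nup; have [nu0 _] := nup.
have -> : avg_chain_int h d nu nu =
    (2%:E * \sum_x (nu x)%:E * chain_int h d2 (meas nu) x)%E.
  rewrite ge0_sume_distrr; last first.
    move=> x _; rewrite mule_ge0 ?lee_fin//; apply: integral_ge0 => r _.
    by rewrite chaining_ext_ge0// meas_le1.
  apply: eq_bigr => x _; rewrite half_chain_int ?measT//; first by rewrite muleCA.
  by move=> A; exact: meas_le1.
have -> : diam d / expR 1 = 2 * (diam d / 2 / expR 1) by field; rewrite gt_eqF// expR_gt0.
rewrite EFinM -muleDr// ?fin_num_adde_defl//.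
by apply: lee_wpmul2l; [rewrite lee_fin|exact: half_avg_chain_int].
Qed.
End Upper.

(** * Peeling off badly spread points *)

Section Peeling.
Variables (R : realType) (X : finType).
Variables (d : X -> X -> R) (h : R -> R) (nu : X -> R).
Implicit Types (x y z : X) (r m : R) (A S : {set X}).
Hypothesis dm : is_metric d.
Hypothesis hp : chaining_profile h.
Hypothesis nup : is_prob nu.

Let nu0 x : 0 <= nu x. Proof. by case: nup. Qed.

Definition gap x y : R := next_dist d (diam d) x y - d x y.

(** The chaining integral of the conditional measure on [S], in the form in
    which a program evaluates it.  It agrees with [chain_int] at the points of
    [S], where all the arguments of [h] are positive. *)
Definition cond_chain S x : R :=
  \sum_y gap x y * h (meas nu (cball d x (d x y) :&: S) / meas nu S).

Definition support : {set X} := [set x | 0 < nu x]%SET.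

Lemma gap_ge0 x y : 0 <= gap x y.
Proof. by rewrite subr_ge0 next_dist_ge// le_diam. Qed.

Lemma sum_gap x : \sum_y gap x y = diam d.
Proof.
by apply: sum_gaps; [exact: metric_ge0|exact: metricxx|exact: le_diam].
Qed.

Lemma meas_support : meas nu support = 1.
Proof.
case: nup => _ <-; rewrite /meas big_mkcond; apply: eq_bigr => x _.
rewrite inE; case: ltP => // nux; apply/eqP; rewrite eq_le nux.
by rewrite andbT.
Qed.

Lemma meas_subsupport S x : S \subset support -> x \in S -> 0 < meas nu S.
Proof.
move=> /fintype.subsetP Ss xS; apply: lt_le_trans (le_meas nu0 xS).
by have := Ss x xS; rewrite inE.
Qed.

Lemma ball_mass_gt0 S x y : S \subset support -> x \in S ->
  0 < meas nu (cball d x (d x y) :&: S).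
Proof.
move=> Ss xS; apply: (@meas_subsupport _ x).
  by apply: fintype.subset_trans Ss; exact: finset.subsetIr.
by rewrite !inE xS andbT metricxx// metric_ge0.
Qed.

Lemma ball_ratio S x y : S \subset support -> x \in S ->
  0 < meas nu (cball d x (d x y) :&: S) / meas nu S <= 1.
Proof.
move=> Ss xS; have S0 := meas_subsupport Ss xS.
rewrite divr_gt0 ?ball_mass_gt0//= ler_pdivrMr// mul1r.
by apply: meas_subset => //; exact: finset.subsetIr.
Qed.

Lemma cond_chainE S x : S \subset support -> x \in S ->
  chain_int h d (cond_meas nu S) x = (cond_chain S x)%:E.
Proof.
move=> Ss xS; have S0 := meas_subsupport Ss xS.
rewrite (chain_int_steps dm hp (le_diam d x)).
- rewrite -sumEFin; apply: eq_bigr => y _.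
  by have /andP[b0 _] := ball_ratio y Ss xS; rewrite chaining_ext_pos.
- by rewrite /cond_meas finset.setTI divff// gt_eqF.
- move=> A; rewrite /cond_meas ler_pdivrMr// mul1r.
  by apply: meas_subset => //; exact: finset.subsetIr.
Qed.

Lemma cond_meas_support A : cond_meas nu support A = meas nu A.
Proof.
rewrite /cond_meas meas_support divr1 -measI_restrict /meas.
apply: eq_bigr => x _; rewrite inE; case: ltP => // nux; apply/eqP.
by rewrite eq_le nux nu0.
Qed.

Definition avg_cond_chain : R := \sum_x nu x * cond_chain support x.

Lemma avg_chain_intE : avg_chain_int h d nu nu = avg_cond_chain%:E.
Proof.
rewrite /avg_chain_int -sumEFin; apply: eq_bigr => x _.
have [nux|nux] := ltP 0 (nu x); last first.
  have -> : nu x = 0 by apply/eqP; rewrite eq_le nux nu0.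
  by rewrite mul0e mul0r.
rewrite EFinM -cond_chainE ?inE//; congr (_ * _)%E; congr (chain_int h d _ x).
by apply/funext => A; rewrite cond_meas_support.
Qed.

(** Conditioning on [S] divides masses by [nu S]; submultiplicativity charges
    [h (nu S)] for it at each radius below the diameter. *)
Lemma cond_chain_support S x : S \subset support -> x \in S ->
  cond_chain support x <= cond_chain S x + diam d * h (meas nu S).
Proof.
move=> Ss xS; rewrite -(sum_gap x) mulr_suml -big_split/=.
apply: ler_sum => y _; rewrite -mulrDr; apply: ler_wpM2l; first exact: gap_ge0.
have S0 := meas_subsupport Ss xS.
have S1 : meas nu S <= 1 by exact: meas_le1.
have /andP[b0 b1] := ball_ratio y Ss xS.
apply: le_trans (profile_mul hp b0 b1 S0 S1).
rewrite divfK ?gt_eqF// meas_support divr1.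
apply: profile_antitone => //; first exact: ball_mass_gt0.
- by apply: meas_subset => //; apply: finset.setIS.
- exact: meas_le1.
Qed.

(** The primitive of [m |-> - ln m] that vanishes at 0; it takes the value 1 at
    1. *)
Definition entropy_primitive m : R := m - m * ln m.

(** As [- ln] is decreasing, its integral over [[m, m + w]] is at least [w]
    times its value at the right end. *)
Lemma entropy_primitive_step m w : 0 <= m -> 0 < w ->
  - (w * ln (m + w)) <= entropy_primitive (m + w) - entropy_primitive m.
Proof.
move=> m0 w0; rewrite /entropy_primitive.
have [->|m_neq0] := eqVneq m 0; first by rewrite !add0r mul0r; lra.
have {m_neq0}m0 : 0 < m by rewrite lt_neqAle eq_sym m_neq0.
have mw0 : 0 < m + w by lra.
have := @le_ln1Dx _ ((m + w) / m - 1).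
rewrite (_ : 1 + (_ - 1) = (m + w) / m); last by rewrite addrC subrK.
have r0 : 0 < (m + w) / m by rewrite divr_gt0.
rewrite ln_div ?posrE// ltrBrDl subrr => /(_ r0) H.
have E : m * ((m + w) / m - 1) = w by field; rewrite gt_eqF.
have : m * (ln (m + w) - ln m) <= w by rewrite -[leRHS]E ler_wpM2l// ltW.
by rewrite mulrBr mulrDl; lra.
Qed.

Definition threshold : R := avg_cond_chain - diam d.

(** What is known about the set that remains after some removals.  The
    inequality is strict as soon as one point has been removed, which is what
    excludes the empty set. *)
Definition peeled S : Prop :=
  S = support \/
  \sum_(x in support :\: S) nu x * cond_chain support x <
    (1 - meas nu S) * threshold + diam d * (1 - entropy_primitive (meas nu S)).

(** For [S] empty the invariant would read: the average of the chaining integral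
    is less than [threshold + diam], which is that average. *)
Lemma peeled_neq0 S : S \subset support -> peeled S -> S != finset.set0.
Proof.
move=> Ss [->|].
  apply/eqP => s0; have := meas_support; rewrite s0 /meas big_set0.
  by move/eqP; rewrite eq_sym oner_eq0.
move=> lt_S; apply/eqP => S0; move: lt_S.
rewrite S0 finset.setD0 {1}/meas /entropy_primitive /meas big_set0 mul0r !subr0.
rewrite mul1r mulr1 /threshold subrK ltNge => /negP; apply.
rewrite /avg_cond_chain [leRHS]big_mkcond; apply: ler_sum => x _.
rewrite inE; case: ltP => // nux.
have -> : nu x = 0 by apply/eqP; rewrite eq_le nux nu0.
by rewrite mul0r.
Qed.

(** The removed point satisfies
    [cond_chain support x < threshold + diam * - ln (nu S)], and
    [nu x * - ln (nu S)] is bounded by the increment of the primitive. *)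
Lemma peeled_step S x : S \subset support -> peeled S -> x \in S ->
  cond_chain S x < threshold -> peeled (S :\ x).
Proof.
move=> Ss pS xS lt_x; right.
have nux : 0 < nu x by have := fintype.subsetP Ss x xS; rewrite inE.
have mE := meas_setU1 nu xS.
set m := meas nu (S :\ x) in mE *.
have m0 : 0 <= m by exact: meas_ge0.
have m1 : meas nu S <= 1 by exact: meas_le1.
have mS0 := meas_subsupport Ss xS.
have D0 := diam_ge0 d.
have step := entropy_primitive_step m0 nux.
rewrite addrC -mE in step.
have hln := profile_le_ln hp mS0 m1.
have le_pS : \sum_(y in support :\: S) nu y * cond_chain support y <=
    (1 - meas nu S) * threshold + diam d * (1 - entropy_primitive (meas nu S)).
  case: pS => [SE|/ltW//].
  rewrite {1}SE finset.setDv big_set0 SE meas_support subrr mul0r add0r.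
  by rewrite /entropy_primitive ln1 mulr0 subr0 subrr mulr0.
have -> : support :\: (S :\ x) = x |: (support :\: S).
  apply/setP => y; rewrite !inE negb_and negbK; have [->|yx] := eqVneq y x.
    by rewrite nux.
  by [].
rewrite big_setU1/=; last by rewrite !inE xS.
have le_x := cond_chain_support Ss xS.
have w_x : nu x * cond_chain support x <
    nu x * threshold + diam d * (entropy_primitive (meas nu S) - entropy_primitive m).
  apply: (@le_lt_trans _ _ (nu x * (cond_chain S x + diam d * h (meas nu S)))).
    exact: ler_wpM2l.
  rewrite mulrDr; apply: ltr_leD; first by rewrite ltr_pM2l.
  rewrite mulrCA; apply: ler_wpM2l => //; apply: le_trans step.
  by rewrite -mulrN; apply: ler_wpM2l.
apply: lt_le_trans (ltr_leD w_x le_pS) _.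
by rewrite mE; lra.
Qed.

Definition well_spread S : Prop :=
  forall x, x \in S -> threshold <= cond_chain S x.

Lemma well_spread_min S : S \subset support -> well_spread S ->
  (avg_chain_int h d nu nu <=
     \big[mine/+oo]_(x in S) chain_int h d (cond_meas nu S) x + (diam d)%:E)%E.
Proof.
move=> Ss wS; rewrite -leeBlDr// avg_chain_intE -EFinB.
apply/bigmin_geP; split=> [|x xS]; first exact: leey.
by rewrite cond_chainE// lee_fin wS.
Qed.

Lemma exists_well_spread : exists S,
  [/\ S != finset.set0, S \subset support & well_spread S].
Proof.
suff H n S : (#|S| <= n)%N -> S \subset support -> peeled S -> exists S,
    [/\ S != finset.set0, S \subset support & well_spread S].
  by apply: (H #|support| support) => //; left.
elim: n S => [|n IH] S cS Ss pS.
  by have := peeled_neq0 Ss pS; rewrite -card_gt0 ltnNge cS.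
have [/existsP[x /andP[xS lt_x]]|] :=
    boolP [exists x, (x \in S) && (cond_chain S x < threshold)].
  apply: (IH (S :\ x)).
  - by move: cS; rewrite (cardsD1 x) xS.
  - by apply: fintype.subset_trans Ss; rewrite finset.subsetDl.
  - exact: peeled_step.
rewrite negb_exists => /forallP H; exists S; split=> //.
  exact: peeled_neq0.
by move=> x xS; have := H x; rewrite xS /= -leNgt.
Qed.
End Peeling.

Section Duality.
Variables (R : realType) (X : finType) (d : X -> X -> R) (h : R -> R).
Hypothesis dm : is_metric d.
Hypothesis hp : chaining_profile h.

(** Test the infimum over [mu] at [mu = nu], and the supremum in [delta_dual]
    at the conditional measure of [nu] on a well spread set. *)
Lemma gamma_dual_le : (gamma_dual h d - (diam d)%:E <= delta_dual h d)%E.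
Proof.
rewrite leeBlDr//; apply: ge_ereal_sup => _ [nu nup <-].
apply: (@le_trans _ _ (avg_chain_int h d nu nu)).
  by apply: ereal_inf_lbound; exists nu.
have [S [S0 Ss wS]] := exists_well_spread dm hp nup.
apply: le_trans (well_spread_min dm hp nup Ss wS) _; rewrite leeD2r//.
have [x xS] := finset.set0Pn _ S0.
have mS := meas_subsupport nup Ss xS; have [nu0 _] := nup.
pose nuS y := if y \in S then nu y / meas nu S else 0.
have nuSE A : meas nuS A = cond_meas nu S A.
  rewrite /cond_meas -measI_restrict /meas mulr_suml; apply: eq_bigr => y _.
  by rewrite /nuS; case: ifP => //; rewrite mul0r.
have nuSp : is_prob nuS.
  split=> [y|].
    by rewrite /nuS; case: ifP => // _; rewrite divr_ge0// meas_ge0.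
  have -> : \sum_y nuS y = meas nuS [set: X]%SET by apply: eq_bigl => y; rewrite inE.
  by rewrite nuSE /cond_meas finset.setTI divff// gt_eqF.
apply: ereal_sup_ubound; exists nuS => //.
apply: eq_big => [y|y _].
  rewrite /nuS; case: ifP => yS; last by rewrite ltxx.
  by rewrite divr_gt0//; have := fintype.subsetP Ss y yS; rewrite inE.
by congr (chain_int h d _ y); apply/funext => A.
Qed.

(** The minimum over the support is at most the average, and the comparison of
    the average with [mu] holds for each [mu] with [nu] unchanged. *)
Lemma delta_dual_le :
  (delta_dual h d <= 2%:E * gamma_dual h d + (diam d / expR 1)%:E)%E.
Proof.
apply: ge_ereal_sup => _ [nu nup <-]; have [nu0 nu1] := nup.
apply: (@le_trans _ _ (avg_chain_int h d nu nu)).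
  set m := \big[_/_]_(_ | _) _.
  have m0 : (0 <= m)%E.
    apply/bigmin_geP; split=> [|x _]; first exact: leey.
    by apply: integral_ge0 => r _; rewrite chaining_ext_ge0// meas_le1.
  have -> : m = (\sum_x (nu x)%:E * m)%E.
    rewrite -ge0_sume_distrl; last by move=> x _; rewrite lee_fin.
    by rewrite sumEFin nu1 mul1e.
  apply: lee_sum => x _; have [nux|nux] := ltP 0 (nu x).
    by apply: lee_wpmul2l; [rewrite lee_fin|exact: bigmin_le_cond].
  have -> : nu x = 0 by apply/eqP; rewrite eq_le nux nu0.
  by rewrite !mul0e.
rewrite -leeBlDr// -lee_pdivrMl//.
apply: (@le_trans _ _ (ereal_inf
  [set avg_chain_int h d mu nu | mu in @is_prob R X]%classic)); last first.
  by apply: ereal_sup_ubound; exists nu.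
apply: le_ereal_inf_tmp => _ [mu mup <-].
by rewrite lee_pdivrMl// leeBlDr//; exact: self_avg_le.
Qed.
End Duality.

(** * Correctness and cost of bounded loops *)

Section CommandSyntax.
Local Open Scope nat_scope.

Fixpoint int_writes (c : cmd) : seq nat :=
  match c with
  | Skip | RSet _ _ _ => [::]
  | ISet a _ _ => [:: a]
  | Seq c1 c2 | If _ c1 c2 => int_writes c1 ++ int_writes c2
  | While _ c1 => int_writes c1
  end.

Fixpoint real_writes (c : cmd) : seq nat :=
  match c with
  | Skip | ISet _ _ _ => [::]
  | RSet a _ _ => [:: a]
  | Seq c1 c2 | If _ c1 c2 => real_writes c1 ++ real_writes c2
  | While _ c1 => real_writes c1
  end.

(** For a program in which every loop runs [n] times, [cost_coef * n ^ cost_degree]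
    bounds the number of steps when [n > 0], [cost_degree] being the nesting
    depth of the loops.  In [cost_coef] the test of a loop is counted twice: once per
    iteration, and once more for the test that ends the loop. *)
Fixpoint cost_degree (c : cmd) : nat :=
  match c with
  | Skip | ISet _ _ _ | RSet _ _ _ => 0
  | Seq c1 c2 | If _ c1 c2 => maxn (cost_degree c1) (cost_degree c2)
  | While _ c1 => (cost_degree c1).+1
  end.

Fixpoint cost_coef (c : cmd) : nat :=
  match c with
  | Skip => 1
  | ISet _ i e => (icost i + icost e).+1
  | RSet _ i e => (icost i + rcost e).+1
  | Seq c1 c2 => cost_coef c1 + cost_coef c2
  | If b c1 c2 => (bcost b).+1 + (cost_coef c1 + cost_coef c2)
  | While b c1 => (bcost b).+1.*2 + cost_coef c1
  end.

Fixpoint loop_free (c : cmd) : bool :=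
  match c with
  | Seq c1 c2 | If _ c1 c2 => loop_free c1 && loop_free c2
  | While _ _ => false
  | _ => true
  end.

Definition int_cell (a : nat) : iexp := IGet a (ICst 0).

(** Every loop is bounded by the number of points, which the input stores in
    cell 0 of integer array 0; the counter is cell 0 of array [v]. *)
Definition for_loop (v : nat) (body : cmd) : cmd :=
  Seq (ISet v (ICst 0) (ICst 0))
      (While (ILe (IBin IAdd (int_cell v) (ICst 1)) (int_cell 0))
         (Seq body (ISet v (ICst 0) (IBin IAdd (int_cell v) (ICst 1))))).

End CommandSyntax.

Section Calculus.
Local Open Scope nat_scope.
Variables (R : realType) (h : R -> R) (n : nat).
Hypothesis n_gt0 : 0 < n.
Implicit Types (s : state R) (c : cmd) (Q : state R -> Prop).

(** Meaningful for loop-free commands only. *)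
Fixpoint effect (c : cmd) (s : state R) : state R :=
  match c with
  | Skip | While _ _ => s
  | ISet a i e => State (upd (imem s) a (ieval s i) (ieval s e)) (rmem s)
  | RSet a i e => State (imem s) (upd (rmem s) a (ieval s i) (reval h s e))
  | Seq c1 c2 => effect c2 (effect c1 s)
  | If b c1 c2 => if beval h s b then effect c1 s else effect c2 s
  end.

(** A command leaves alone the arrays that its text does not assign; this
    carries the facts about the other arrays through loops. *)
Definition frame c s s' : Prop :=
  (forall a j, a \notin int_writes c -> imem s' a j = imem s a j) /\
  (forall a j, a \notin real_writes c -> rmem s' a j = rmem s a j).

Lemma exec_frame c s s' k : exec h c s s' k -> frame c s s'.
Proof.
elim=> {c s s' k}.
- by [].
- move=> a i e s; split=> // b j /=; rewrite inE /upd => /negbTE ->//.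
- move=> a i e s; split=> // b j /=; rewrite inE /upd => /negbTE ->//.
- move=> c1 c2 s s1 s2 k1 k2 _ [i1 r1] _ [i2 r2]; split=> a j /=;
    rewrite mem_cat negb_or => /andP[a1 a2].
    by rewrite i2// i1.
  by rewrite r2// r1.
- move=> b c1 c2 s s' k _; case: ifP => _ [i1 r1]; split=> a j /=;
    rewrite mem_cat negb_or => /andP[a1 a2]; by [rewrite i1|rewrite r1].
- by [].
- move=> b c s s1 s2 k1 k2 _ _ [i1 r1] _ [i2 r2]; split=> a j /= ac.
    by rewrite i2// i1.
  by rewrite r2// r1.
Qed.

Lemma frame_trans c s1 s2 s3 : frame c s1 s2 -> frame c s2 s3 -> frame c s1 s3.
Proof.
by move=> [i1 r1] [i2 r2]; split=> a j ac; [rewrite i2// i1|rewrite r2// r1].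
Qed.

Definition cost_bound c : nat := cost_coef c * n ^ cost_degree c.

(** A weakest precondition that also asserts termination within the syntactic
    cost bound, so that time never has to be mentioned again. *)
Definition wp c Q s : Prop :=
  exists s' k, [/\ exec h c s s' k, k <= cost_bound c & Q s'].

Lemma leq_cost (a : nat) q q' : q <= q' -> a * n ^ q <= a * n ^ q'.
Proof. by move=> qq; rewrite leq_mul// leq_pexp2l. Qed.

Lemma wp_conseq c (Q Q' : state R -> Prop) s : wp c Q s ->
  (forall s', frame c s s' -> Q s' -> Q' s') -> wp c Q' s.
Proof.
move=> [s' [k [ex kb Qs]]] QQ; exists s', k; split=> //.
by apply: QQ => //; exact: exec_frame ex.
Qed.

Lemma wp_loop_free c Q s : loop_free c -> Q (effect c s) -> wp c Q s.
Proof.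
move=> lc Qs.
suff [k [ex kb]] : exists k, exec h c s (effect c s) k /\ k <= cost_bound c.
  by exists (effect c s), k.
elim: c s lc {Qs} => //=.
- by move=> s _; exists 1; split; [constructor|rewrite /cost_bound muln1].
- by move=> a i e s _; eexists; split; [constructor|rewrite /cost_bound /= muln1].
- by move=> a i e s _; eexists; split; [constructor|rewrite /cost_bound /= muln1].
- move=> c1 IH1 c2 IH2 s /andP[/IH1-/(_ s)[k1 [e1 b1]] /IH2-/(_ (effect c1 s))[k2 [e2 b2]]].
  exists (k1 + k2); split; first exact: ExecSeq e1 e2.
  rewrite /cost_bound /= mulnDl leq_add//.
    by apply: leq_trans b1 (leq_cost _ _); rewrite leq_maxl.
  by apply: leq_trans b2 (leq_cost _ _); rewrite leq_maxr.
- move=> b c1 IH1 c2 IH2 s /andP[/IH1-/(_ s)[k1 [e1 b1]] /IH2-/(_ s)[k2 [e2 b2]]].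
  have n1 q : 0 < n ^ q by rewrite expn_gt0 n_gt0.
  have := leq_cost (cost_coef c1) (leq_maxl (cost_degree c1) (cost_degree c2)).
  have := leq_cost (cost_coef c2) (leq_maxr (cost_degree c1) (cost_degree c2)).
  have := n1 (maxn (cost_degree c1) (cost_degree c2)).
  rewrite /cost_bound /= in b1 b2 *; set N := n ^ _ => N0 le2 le1.
  case: (boolP (beval h s b)) => bs.
    exists (bcost b + k1).+1; split; first by apply: ExecIf; rewrite bs.
    nia.
  exists (bcost b + k2).+1; split; first by apply: ExecIf; rewrite (negbTE bs).
  nia.
Qed.

Lemma wp_seq c1 c2 Q s : wp c1 (wp c2 Q) s -> wp (Seq c1 c2) Q s.
Proof.
move=> [s1 [k1 [e1 b1 [s2 [k2 [e2 b2 Qs]]]]]].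
exists s2, (k1 + k2); split=> //; first exact: ExecSeq e1 e2.
rewrite /cost_bound /= mulnDl leq_add//.
  by apply: leq_trans b1 (leq_cost _ _); rewrite leq_maxl.
by apply: leq_trans b2 (leq_cost _ _); rewrite leq_maxr.
Qed.

Lemma wp_if b c1 c2 Q s :
  (beval h s b -> wp c1 Q s) -> (~~ beval h s b -> wp c2 Q s) ->
  wp (If b c1 c2) Q s.
Proof.
move=> H1 H2.
have n1 q : 0 < n ^ q by rewrite expn_gt0 n_gt0.
have := leq_cost (cost_coef c1) (leq_maxl (cost_degree c1) (cost_degree c2)).
have := leq_cost (cost_coef c2) (leq_maxr (cost_degree c1) (cost_degree c2)).
have := n1 (maxn (cost_degree c1) (cost_degree c2)).
case: (boolP (beval h s b)) => bs N0 le2 le1.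
  have [s' [k [e kb Qs]]] := H1 bs; exists s', (bcost b + k).+1; split=> //.
    by apply: ExecIf; rewrite bs.
  by rewrite /cost_bound /= in kb *; nia.
have [s' [k [e kb Qs]]] := H2 bs; exists s', (bcost b + k).+1; split=> //.
  by apply: ExecIf; rewrite (negbTE bs).
by rewrite /cost_bound /= in kb *; nia.
Qed.

Definition set_counter s v m : state R :=
  State (upd (imem s) v 0 m) (rmem s).

(** Induction on the number of iterations that remain.  The invariant survives
    the increment because it is insensitive to the counter, and the bound is
    constant because the body does not write to its array. *)
Lemma wp_for v body (Inv : nat -> state R -> Prop) Q s0 :
  v != 0 -> v \notin int_writes body -> 0 \notin int_writes body ->
  imem s0 0 0 = n ->
  (forall i s m, Inv i s -> Inv i (set_counter s v m)) ->
  Inv 0 s0 ->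
  (forall i s, i < n -> frame (for_loop v body) s0 s -> imem s v 0 = i ->
     Inv i s -> wp body (Inv i.+1) s) ->
  (forall s, frame (for_loop v body) s0 s -> Inv n s -> Q s) ->
  wp (for_loop v body) Q s0.
Proof.
move=> v0 vb b0 s0n stable Inv0 step post.
set test := ILe (IBin IAdd (int_cell v) (ICst 1)) (int_cell 0).
set incr := ISet v (ICst 0) (IBin IAdd (int_cell v) (ICst 1)).
(* One iteration costs 7 for the test, 6 for the increment and 1 for the loop;
   the last test costs 8. *)
pose K := cost_bound body + 14.

have z0 : 0 \notin int_writes (for_loop v body).
  by rewrite /= !(inE, mem_cat) !negb_or b0 eq_sym v0.
have loop m i s : m + i = n -> frame (for_loop v body) s0 s -> imem s v 0 = i ->
    Inv i s -> exists s' k, [/\ exec h (While test (Seq body incr)) s s' k,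
      k <= m * K + 8, frame (for_loop v body) s0 s' & Inv n s'].
  elim: m i s => [|m IH] i s mi fr si Is.
    exists s, 8; split=> //; last by rewrite -mi.
    apply: (ExecWhileF (b := test)).
    by rewrite /= si fr.1// s0n -mi addn1 add0n ltnn.
  have i_lt : i < n by lia.
  have n_s : imem s 0 0 = n by rewrite fr.1.
  have [s1 [k1 [e1 b1 I1]]] := step i s i_lt fr si Is.
  have fr1 := exec_frame e1.
  have v1 : imem s1 v 0 = i by rewrite fr1.1.
  pose s2 := set_counter s1 v i.+1.
  have e2 : exec h incr s1 s2 6.
    have := ExecISet h v (ICst 0) (IBin IAdd (int_cell v) (ICst 1)) s1.
    by rewrite /= v1 addn1.
  have e12 : exec h (Seq body incr) s s2 (k1 + 6) by exact: ExecSeq e1 e2.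
  have v2 : imem s2 v 0 = i.+1 by rewrite /= /upd !eqxx.
  have fr2 : frame (for_loop v body) s0 s2.
    apply: frame_trans fr _; have [i12 r12] := exec_frame e12.
    split=> a j /=; first by rewrite inE negb_or => /andP[_]; exact: i12.
    exact: r12.
  have mi' : m + i.+1 = n by lia.
  have [s' [k [e kb fr' I']]] := IH i.+1 s2 mi' fr2 v2 (stable _ _ _ I1).
  exists s', (7 + (k1 + 6) + k).+1; split=> //; last first.
    by rewrite /K in b1 kb *; rewrite mulSn; lia.
  apply: (ExecWhileT (b := test)) e12 e.
  by rewrite /= si n_s addn1.
have e0 : exec h (ISet v (ICst 0) (ICst 0)) s0 (set_counter s0 v 0) 3.
  exact: (ExecISet h v (ICst 0) (ICst 0) s0).
have fr0 : frame (for_loop v body) s0 (set_counter s0 v 0).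
  split=> // a j; rewrite /= inE negb_or /upd => /andP[/negbTE-> _] //.
have v00 : imem (set_counter s0 v 0) v 0 = 0 by rewrite /= /upd !eqxx.
have [s' [k [e kb fr' I']]] := loop n 0 (set_counter s0 v 0) (addn0 n)
  fr0 v00 (stable _ _ _ Inv0).
exists s', (3 + k); split; [exact: ExecSeq e0 e| |exact: post].
rewrite /cost_bound /= maxn0 max0n expnS.
have : 0 < n ^ cost_degree body by rewrite expn_gt0 n_gt0.
by rewrite /K /cost_bound in kb; set N := n ^ _ in kb *; nia.
Qed.

Variable X : finType.
Hypothesis nX : #|X| = n.

Definition idx (x : X) : nat := enum_rank x.

Lemma idx_lt x : idx x < n. Proof. by rewrite -nX ltn_ord. Qed.

Lemma idx_inj : injective idx.
Proof. by move=> x y /val_inj/enum_rank_inj. Qed.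

Lemma idx_eq x y : (idx x == idx y) = (x == y).
Proof. exact: (inj_eq idx_inj). Qed.

Lemma idx_ltS x y : (idx y < (idx x).+1) = (y == x) || (idx y < idx x).
Proof. by rewrite ltnS leq_eqVlt idx_eq. Qed.

Lemma idx2_eq x y x' y' :
  (idx x * n + idx y == idx x' * n + idx y') = (x == x') && (y == y').
Proof.
rewrite -!idx_eq; apply/eqP/andP => [E|[/eqP-> /eqP->]//].
have := congr1 (divn^~ n) E; have := congr1 (modn^~ n) E => /=.
rewrite !modnMDl !modn_small ?idx_lt// !divnMDl// !divn_small ?idx_lt// !addn0.
by move=> -> ->; rewrite !eqxx.
Qed.

(** Loops over [0, n[ are loops over the points of [X] in the order of their
    ranks. *)
Lemma wp_for_points v body (Inv : nat -> state R -> Prop) Q s0 :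
  v != 0 -> v \notin int_writes body -> 0 \notin int_writes body ->
  imem s0 0 0 = n ->
  (forall i s m, Inv i s -> Inv i (set_counter s v m)) ->
  Inv 0 s0 ->
  (forall x s, frame (for_loop v body) s0 s -> imem s v 0 = idx x ->
     Inv (idx x) s -> wp body (Inv (idx x).+1) s) ->
  (forall s, frame (for_loop v body) s0 s -> Inv n s -> Q s) ->
  wp (for_loop v body) Q s0.
Proof.
move=> v0 vb b0 s0n stable Inv0 step post.
apply: (wp_for (Inv := Inv)) => // i s i_lt fr si Is.
have i_ltX : i < #|X| by rewrite nX.
have iE : i = idx (enum_val (Ordinal i_ltX)) by rewrite /idx enum_valK.
by rewrite iE in si Is *; exact: step.
Qed.
End Calculus.

(** * The peeling program *)

Section Program.
Local Open Scope nat_scope.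

Definition real_cell (a : nat) : rexp := RGet a (ICst 0).
Definition pair_at (i j : iexp) : iexp := IBin IAdd (IBin IMul i (int_cell 0)) j.

Local Notation I := (int_cell 2).
Local Notation J := (int_cell 3).
Local Notation K := (int_cell 4).
Local Notation found := (int_cell 6).
Local Notation dist i j := (RGet 0 (pair_at i j)).

(** Memory layout.  Integer arrays: 0 size, 1 marks of the remaining set [S],
    2 to 5 loop counters, 6 outcome of a search.  Real arrays: 0 distances,
    1 masses, 2 the table of [nu (B x (d x y) :&: S)], 3 the table of gaps, 4
    diameter, 5 threshold, 6 accumulator, 7 [nu S], 8 next distance. *)
Definition diam_prog : cmd :=
  Seq (RSet 4 (ICst 0) (RCst 0))
      (for_loop 2 (for_loop 3
         (If (RLe (dist I J) (real_cell 4)) Skip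
             (RSet 4 (ICst 0) (dist I J))))).

(** Accumulates, over [z], the mass of the ball of radius [d x y] around [x] and
    the minimum of [d x z] over the points [z] farther than [y]. *)
Definition scan_body : cmd :=
  let update := If (RLe (real_cell 8) (dist I K)) Skip
                   (RSet 8 (ICst 0) (dist I K)) in
  Seq (If (RLe (dist I K) (dist I J))
          (RSet 6 (ICst 0) (RBin RAdd (real_cell 6) (RGet 1 K))) Skip)
      (If (RLe (dist I K) (dist I J))
          (If (RLe (dist I J) (dist I K))
              (If (ILe (IBin IAdd J (ICst 1)) K) update Skip) Skip)
          update).

Definition table_body : cmd :=
  Seq (Seq (RSet 6 (ICst 0) (RCst 0)) (RSet 8 (ICst 0) (real_cell 4)))
  (Seq (for_loop 4 scan_body)
       (Seq (RSet 2 (pair_at I J) (real_cell 6))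
            (RSet 3 (pair_at I J) (RBin RSub (real_cell 8) (dist I J))))).

Definition table_prog : cmd := for_loop 2 (for_loop 3 table_body).

Definition keep_prog : cmd :=
  Seq (RSet 7 (ICst 0) (RCst 1))
      (for_loop 2 (If (RLe (RGet 1 I) (RCst 0)) (ISet 1 I (ICst 0))
                      (ISet 1 I (ICst 1)))).

Definition chain_prog : cmd :=
  Seq (RSet 6 (ICst 0) (RCst 0))
      (for_loop 3 (RSet 6 (ICst 0) (RBin RAdd (real_cell 6)
         (RBin RMul (RGet 3 (pair_at I J))
            (ROracle (RBin RDiv (RGet 2 (pair_at I J)) (real_cell 7))))))).

Definition threshold_prog : cmd :=
  Seq (RSet 5 (ICst 0) (RCst 0))
  (Seq (for_loop 2 (Seq chain_prog
         (RSet 5 (ICst 0) (RBin RAdd (real_cell 5)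
            (RBin RMul (RGet 1 I) (real_cell 6))))))
       (RSet 5 (ICst 0) (RBin RSub (real_cell 5) (real_cell 4)))).

(** Cell 6 keeps the value [n], which is the rank of no point, when the search
    finds nothing to remove. *)
Definition search_prog : cmd :=
  Seq (ISet 6 (ICst 0) (int_cell 0))
      (for_loop 2 (If (ILe (ICst 1) (IGet 1 I))
         (Seq chain_prog
              (If (RLe (real_cell 5) (real_cell 6)) Skip (ISet 6 (ICst 0) I)))
         Skip)).

Definition remove_prog : cmd :=
  Seq (Seq (ISet 1 found (ICst 0))
           (RSet 7 (ICst 0) (RBin RSub (real_cell 7) (RGet 1 found))))
      (for_loop 2 (for_loop 3
         (If (RLe (dist I found) (dist I J))
             (RSet 2 (pair_at I J)
                (RBin RSub (RGet 2 (pair_at I J)) (RGet 1 found)))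
             Skip))).

(** Each of the [n] rounds removes a point or finds that none can be removed;
    [n] rounds suffice because the set cannot be emptied. *)
Definition peel_prog : cmd :=
  for_loop 5 (Seq search_prog
    (If (ILe (IBin IAdd found (ICst 1)) (int_cell 0)) remove_prog Skip)).

Definition spread_prog : cmd :=
  Seq diam_prog (Seq table_prog (Seq keep_prog (Seq threshold_prog peel_prog))).

End Program.

Section Correctness.
Variables (R : realType) (X : finType).
Variables (d : X -> X -> R) (h : R -> R) (nu : X -> R).
Implicit Types (x y z : X) (S : {set X}) (s : state R).
Hypothesis dm : is_metric d.
Hypothesis hp : chaining_profile h.
Hypothesis nup : is_prob nu.

Local Notation n := #|X|.
Local Notation input := (holds_input d nu).
Local Notation wp := (wp h n).

Let n_gt0 : (0 < n)%N.
Proof.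
rewrite lt0n; apply/eqP => X0; case: nup => _; rewrite big1; first last.
  by move=> x; have := fintype.card0_eq X0 x; rewrite inE.
by move/eqP; rewrite eq_sym oner_eq0.
Qed.

Let nX : #|X| = n. Proof. by []. Qed.
Let idx_lt_n := idx_lt nX.

Lemma frame_input c s s' : frame c s s' -> input s ->
  (0 \notin int_writes c)%N -> (0 \notin real_writes c)%N ->
  (1 \notin real_writes c)%N -> input s'.
Proof.
move=> [fi fr] [sn sd sm] i0 r0 r1; split=> [|x y|x].
- by rewrite fi.
- by rewrite fr.
- by rewrite fr.
Qed.

(** One iteration of an accumulating loop. *)
Lemma sum_idxS (P : pred X) (F : X -> R) z :
  \sum_(y | (idx y < (idx z).+1)%N && P y) F y =
  (if P z then F z else 0) + \sum_(y | (idx y < idx z)%N && P y) F y.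
Proof.
case: ifP => Pz; last first.
  rewrite add0r; apply: eq_bigl => y; rewrite idx_ltS.
  by case: eqVneq => // ->; rewrite Pz andbF ltnn.
rewrite (bigD1 z)/= ?ltnSn//; congr (_ + _); apply: eq_bigl => y.
by rewrite idx_ltS; case: eqVneq => [->|] /=; rewrite ?andbF ?ltnn// andbT.
Qed.

Lemma diam_prog_spec s : input s ->
  wp diam_prog (fun s' => rmem s' 4 0 = diam d) s.
Proof.
move=> ins; apply: wp_seq => //; apply: wp_loop_free => //=.
set s1 := State _ _.
have in1 : input s1 by case: ins.
have [n1 _ _] := in1.
apply: (@wp_for_points _ _ _ n_gt0 X nX _ _ (fun i s' =>
  [/\ 0 <= rmem s' 4 0, rmem s' 4 0 <= diam d &
      forall x y, (idx x < i)%N -> d x y <= rmem s' 4 0])) => //.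
- by split=> //=; exact: diam_ge0.
- move=> x s2 fr2 i2 [D0 Dd Dx].
  have in2 := frame_input fr2 in1 isT isT isT; have [n2 _ _] := in2.
  apply: (@wp_for_points _ _ _ n_gt0 X nX _ _ (fun j s' =>
    [/\ 0 <= rmem s' 4 0, rmem s' 4 0 <= diam d &
      forall x' y, (idx x' < idx x)%N || ((x' == x) && (idx y < j)%N) ->
      d x' y <= rmem s' 4 0])) => //.
  + split=> // x' y; rewrite ltn0 andbF orbF; exact: Dx.
  + move=> y s3 fr3 j3 [D0' Dd' Dx'].
    have [n3 d3 _] := frame_input fr3 in2 isT isT isT.
    have i3 : imem s3 2 0 = idx x by rewrite fr3.1.
    apply: wp_loop_free => //=; rewrite i3 j3 n3 d3.
    case: ifP => [le_D|/negbT]; last first.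
      rewrite -ltNge => lt_D; split=> /=.
      * exact: metric_ge0.
      * exact: le_diam.
      * move=> x' y'; rewrite idx_ltS andb_orr orbCA => /orP[/andP[/eqP-> /eqP->]//|xy].
        by rewrite ltW// (le_lt_trans (Dx' _ _ xy)).
    split=> // x' y'; rewrite idx_ltS andb_orr orbCA => /orP[/andP[/eqP-> /eqP->]//|].
    exact: Dx'.
  + move=> s3 _ [D0' Dd' Dx']; split=> // x' y; rewrite idx_ltS => xx'.
    by apply: Dx'; rewrite idx_lt_n andbT orbC.
move=> s2 _ [D0 Dd Dx]; apply/eqP; rewrite eq_le Dd.
apply/bigmax_leP; split=> // x _; apply/bigmax_leP; split=> // y _.
by apply: Dx; exact: idx_lt_n.
Qed.

Lemma scan_spec s x y : input s -> rmem s 4 0 = diam d ->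
  imem s 2 0 = idx x -> imem s 3 0 = idx y ->
  rmem s 6 0 = 0 -> rmem s 8 0 = diam d ->
  wp (for_loop 4 scan_body) (fun s' =>
    rmem s' 6 0 = meas nu (cball d x (d x y)) /\
    rmem s' 8 0 = next_dist d (diam d) x y) s.
Proof.
move=> ins sD si sj s6 s8; have [sn _ _] := ins.
apply: (@wp_for_points _ _ _ n_gt0 X nX _ _ (fun k s' =>
  [/\ rmem s' 6 0 = \sum_(z | (idx z < k)%N && (d x z <= d x y)) nu z,
      rmem s' 8 0 <= diam d,
      forall z, (idx z < k)%N -> farther d x y z -> rmem s' 8 0 <= d x z &
      rmem s' 8 0 = diam d \/
      exists2 z, farther d x y z & rmem s' 8 0 = d x z])) => //.
- by split; rewrite ?s8//; [rewrite s6 big_pred0|left].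
- move=> z s1 fr1 k1 [acc nD nz nE].
  have [n1 d1 m1] := frame_input fr1 ins isT isT isT.
  have i1 : imem s1 2 0 = idx x by rewrite fr1.1.
  have j1 : imem s1 3 0 = idx y by rewrite fr1.1.
  apply: wp_seq => //.
  apply: (wp_conseq (Q := fun s2 => rmem s2 6 0 =
      (if d x z <= d x y then nu z else 0) + rmem s1 6 0)).
    apply: wp_loop_free => //=; rewrite i1 j1 k1 n1 !d1.
    by case: ifP => _; rewrite /= ?add0r// /upd /= m1 addrC.
  move=> s2 fr2 acc2.
  have [n2 d2 _] := frame_input fr2 (frame_input fr1 ins isT isT isT) isT isT isT.
  have i2 : imem s2 2 0 = idx x by rewrite fr2.1.
  have j2 : imem s2 3 0 = idx y by rewrite fr2.1.
  have k2 : imem s2 4 0 = idx z by rewrite fr2.1.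
  have e2 : rmem s2 8 0 = rmem s1 8 0 by rewrite fr2.2.
  apply: (wp_conseq (Q := fun s3 => rmem s3 8 0 =
      if farther d x y z && (d x z < rmem s1 8 0) then d x z else rmem s1 8 0)).
    apply: wp_loop_free => //=; rewrite i2 j2 k2 n2 !d2 e2 addn1.
    rewrite /farther -/(idx y) -/(idx z).
    case: (ltgtP (d x y) (d x z)) => [yz|zy|yz] /=.
    - by rewrite ltNge; case: ifP => _ //=; rewrite /upd /=.
    - by [].
    - by case: ifP => _ //=; rewrite ltNge; case: ifP => _ //=; rewrite /upd /=.
  move=> s3 fr3 e3; rewrite fr3.2// acc2 acc sum_idxS; split=> //.
  + by rewrite e3; case: ifP => // /andP[_ /ltW/le_trans]; apply.
  + move=> z'; rewrite idx_ltS => /orP[/eqP-> far|z'z far].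
      by rewrite e3 far /=; case: ltP.
    rewrite e3; case: ifP => [/andP[_ lt_z]|_]; last exact: nz.
    by rewrite (le_trans (ltW lt_z))// nz.
  + by rewrite e3; case: ifP => // /andP[far _]; right; exists z.
- move=> s1 _ [acc nD nz nE]; split.
    rewrite acc; apply: eq_bigl => z; by rewrite inE idx_lt_n.
  apply: next_distE => // z; apply: nz; exact: idx_lt_n.
Qed.

Lemma table_prog_spec s : input s -> rmem s 4 0 = diam d ->
  wp table_prog (fun s' => forall x y,
    rmem s' 2 (idx x * n + idx y)%N = meas nu (cball d x (d x y)) /\
    rmem s' 3 (idx x * n + idx y)%N = gap d x y) s.
Proof.
move=> ins sD; have [sn _ _] := ins.
pose ok s' x y := rmem s' 2 (idx x * n + idx y)%N = meas nu (cball d x (d x y)) /\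
    rmem s' 3 (idx x * n + idx y)%N = gap d x y.
apply: (@wp_for_points _ _ _ n_gt0 X nX _ _ (fun i s' =>
  forall x y, (idx x < i)%N -> ok s' x y)) => //; last first.
  by move=> s1 _ H x y; apply: H; exact: idx_lt_n.
move=> x s1 fr1 i1 ok1.
have in1 := frame_input fr1 ins isT isT isT; have [n1 _ _] := in1.
apply: (@wp_for_points _ _ _ n_gt0 X nX _ _ (fun j s' =>
  forall x' y, (idx x' < idx x)%N || ((x' == x) && (idx y < j)%N) ->
  ok s' x' y)) => //.
- by move=> x' y; rewrite ltn0 andbF orbF; exact: ok1.
- move=> y s2 fr2 j2 ok2.
  have in2 := frame_input fr2 in1 isT isT isT.
  have i2 : imem s2 2 0 = idx x by rewrite fr2.1.
  have D2 : rmem s2 4 0 = diam d by rewrite fr2.2// fr1.2.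
  apply: wp_seq => //; apply: wp_loop_free => //=.
  set s3 := State _ _.
  have in3 : input s3 by case: in2.
  apply: wp_seq => //.
  apply: wp_conseq (scan_spec in3 D2 i2 j2 erefl D2) _.
  move=> s4 fr4 [acc4 next4].
  have [n4 d4 _] := frame_input fr4 in3 isT isT isT.
  have i4 : imem s4 2 0 = idx x by rewrite fr4.1.
  have j4 : imem s4 3 0 = idx y by rewrite fr4.1.
  apply: wp_loop_free => //= x' y'.
  rewrite idx_ltS andb_orr orbCA /ok /= /upd /= i4 j4 n4 d4 !idx2_eq//.
  case: eqVneq => [->|] /=; last first.
    rewrite orbF => xx' lt_x.
    by rewrite !fr4.2//; apply: ok2; rewrite lt_x.
  case: eqVneq => [-> _|yy'] /=; first by split; [rewrite acc4|rewrite next4].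
  by move=> H; rewrite !fr4.2//; apply: ok2; rewrite eqxx.
- move=> s2 _ H x' y; rewrite idx_ltS => xx'.
  by apply: H; rewrite idx_lt_n andbT orbC.
Qed.
Local Notation chain := (cond_chain d h nu).
Local Notation supp := (support nu).
Local Notation thr := (threshold d h nu).

(** The tables are those of the current set [S]. *)
Definition stores S s : Prop :=
  [/\ forall x, imem s 1 (idx x) = (x \in S),
      forall x y, rmem s 2 (idx x * n + idx y)%N = meas nu (cball d x (d x y) :&: S),
      forall x y, rmem s 3 (idx x * n + idx y)%N = gap d x y &
      rmem s 7 0 = meas nu S].

Lemma frame_stores c S s s' : frame c s s' -> stores S s ->
  (1 \notin int_writes c)%N -> (2 \notin real_writes c)%N ->
  (3 \notin real_writes c)%N -> (7 \notin real_writes c)%N -> stores S s'.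
Proof.
move=> [fi fr] [k w g m] i1 r2 r3 r7.
by split=> [x|x y|x y|]; rewrite ?fi ?fr.
Qed.

Lemma keep_prog_spec s : input s ->
  wp keep_prog (fun s' => rmem s' 7 0 = 1 /\
    forall x, imem s' 1 (idx x) = (x \in supp)) s.
Proof.
move=> ins; apply: wp_seq => //; apply: wp_loop_free => //=.
set s1 := State _ _.
have in1 : input s1 by case: ins.
have [n1 _ _] := in1.
apply: (@wp_for_points _ _ _ n_gt0 X nX _ _ (fun i s' =>
  rmem s' 7 0 = 1 /\ forall x, (idx x < i)%N -> imem s' 1 (idx x) = (x \in supp))) => //.
- move=> x s2 fr2 i2 [m2 k2].
  have [n3 _ nu3] := frame_input fr2 in1 isT isT isT.
  apply: wp_loop_free => //=; rewrite i2 nu3.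
  have -> : (nu x <= 0) = (x \notin supp) by rewrite inE -leNgt.
  by case: (boolP (x \in supp)) => xs /=; split=> // y; rewrite idx_ltS /upd /= idx_eq;
    case: eqVneq => [->|_] /=; rewrite ?(negbTE xs) ?xs//; exact: k2.
- by move=> s2 _ [m2 k2]; split=> // x; apply: k2; exact: idx_lt_n.
Qed.

Lemma chain_prog_spec S s x : input s -> stores S s -> imem s 2 0 = idx x ->
  wp chain_prog (fun s' => rmem s' 6 0 = chain S x) s.
Proof.
move=> ins ts i0; apply: wp_seq => //; apply: wp_loop_free => //=.
set s1 := State _ _.
have in1 : input s1 by case: ins.
have ts1 : stores S s1 by case: ts.
have [n1 _ _] := in1.
apply: (@wp_for_points _ _ _ n_gt0 X nX _ _ (fun j s' =>
  rmem s' 6 0 = \sum_(y | (idx y < j)%N && true) (gap d x y *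
    h (meas nu (cball d x (d x y) :&: S) / meas nu S)))) => //.
- by rewrite /= /upd /= big_pred0.
- move=> y s2 fr2 j2 acc2.
  have [n2 _ _] := frame_input fr2 in1 isT isT isT.
  have [_ w2 g2 m2] := frame_stores fr2 ts1 isT isT isT isT.
  have i2 : imem s2 2 0 = idx x by rewrite fr2.1.
  apply: wp_loop_free => //=.
  by rewrite /upd /= i2 j2 n2 w2 g2 m2 acc2 (sum_idxS xpredT) addrC.
- move=> s2 _ ->; apply: eq_bigl => y; by rewrite idx_lt_n.
Qed.

Lemma threshold_prog_spec s : input s -> stores supp s -> rmem s 4 0 = diam d ->
  wp threshold_prog (fun s' => rmem s' 5 0 = thr) s.
Proof.
move=> ins ts sD; apply: wp_seq => //; apply: wp_loop_free => //=.
set s1 := State _ _.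
have in1 : input s1 by case: ins.
have ts1 : stores supp s1 by case: ts.
have [n1 _ _] := in1.
apply: wp_seq => //.
apply: (@wp_for_points _ _ _ n_gt0 X nX _ _ (fun i s' =>
  rmem s' 5 0 = \sum_(x | (idx x < i)%N && true) nu x * chain supp x)) => //.
- by rewrite /= /upd /= big_pred0.
- move=> x s2 fr2 i2 acc2.
  have in2 := frame_input fr2 in1 isT isT isT.
  have ts2 := frame_stores fr2 ts1 isT isT isT isT.
  apply: wp_seq => //; apply: wp_conseq (chain_prog_spec in2 ts2 i2) _.
  move=> s3 fr3 c3.
  have [n3 _ nu3] := frame_input fr3 in2 isT isT isT.
  have i3 : imem s3 2 0 = idx x by rewrite fr3.1.
  have acc3 : rmem s3 5 0 = rmem s2 5 0 by rewrite fr3.2.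
  apply: wp_loop_free => //=.
  by rewrite /upd /= i3 nu3 c3 acc3 acc2 (sum_idxS xpredT) addrC.
- move=> s2 fr2 acc2; apply: wp_loop_free => //=.
  have D2 : rmem s2 4 0 = diam d by rewrite fr2.2.
  rewrite /upd /= acc2 D2 /threshold; congr (_ - _).
  by apply: eq_bigl => x; rewrite idx_lt_n.
Qed.

Lemma search_prog_spec S s : input s -> stores S s -> rmem s 5 0 = thr ->
  wp search_prog (fun s' =>
    (imem s' 6 0 = n /\ well_spread d h nu S) \/
    exists x, [/\ x \in S, imem s' 6 0 = idx x & chain S x < thr]) s.
Proof.
move=> ins ts sT; have [sn _ _] := ins; apply: wp_seq => //; apply: wp_loop_free => //=.
set s1 := State _ _.
have in1 : input s1 by case: ins.
have ts1 : stores S s1 by case: ts.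
have [n1 _ _] := in1.
apply: (@wp_for_points _ _ _ n_gt0 X nX _ _ (fun i s' =>
  (imem s' 6 0 = n /\ forall x, (idx x < i)%N -> x \in S -> thr <= chain S x) \/
  exists x, [/\ x \in S, imem s' 6 0 = idx x & chain S x < thr])) => //.
- by left; rewrite /= /upd /=; split.
- move=> x s2 fr2 i2 inv2.
  have in2 := frame_input fr2 in1 isT isT isT.
  have ts2 := frame_stores fr2 ts1 isT isT isT isT.
  have [k2 _ _ _] := ts2.
  apply: wp_if => //=; rewrite i2 k2 lt0b => xS; last first.
    apply: wp_loop_free => //=; case: inv2 => [[f2 H]|]; [left|by right].
    by split=> // y; rewrite idx_ltS => /orP[/eqP->|]; [rewrite (negbTE xS)|exact: H].
  apply: wp_seq => //; apply: wp_conseq (chain_prog_spec in2 ts2 i2) _.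
  move=> s3 fr3 c3.
  have i3 : imem s3 2 0 = idx x by rewrite fr3.1.
  have T3 : rmem s3 5 0 = thr by rewrite fr3.2// fr2.2.
  apply: wp_loop_free => //=; rewrite T3 c3.
  case: leP => le_thr; last by right; exists x; rewrite /= /upd /= i3.
  rewrite fr3.1//; case: inv2 => [[f2 H]|]; [left|by right].
  by split=> // y; rewrite idx_ltS => /orP[/eqP->|]; [|exact: H].
- move=> s2 _ [[f2 H]|]; [left|by right]; split=> // x; apply: H; exact: idx_lt_n.
Qed.

Lemma remove_prog_spec S s x : input s -> stores S s -> imem s 6 0 = idx x ->
  x \in S -> wp remove_prog (stores (S :\ x)) s.
Proof.
move=> ins ts fs xS; apply: wp_seq => //; apply: wp_loop_free => //=; rewrite fs.
set s1 := State _ _.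
have in1 : input s1 by case: ins.
have [n1 _ _] := in1.
have [k0 w0 g0 m0] := ts; have [_ _ nu0] := ins.
have k1 y : imem s1 1 (idx y) = (y \in S :\ x).
  by rewrite /= /upd /= idx_eq !inE; case: eqVneq => //= _; rewrite k0.
have m1 : rmem s1 7 0 = meas nu (S :\ x).
  by rewrite /= /upd /= m0 fs nu0 (meas_setU1 _ xS) addrC addKr.
have ball_rem y z : meas nu (cball d y (d y z) :&: (S :\ x)) =
    meas nu (cball d y (d y z) :&: S) - (if d y x <= d y z then nu x else 0).
  rewrite finset.setIDA; case: ifP => xb.
    by rewrite (@meas_setU1 _ _ _ (_ :&: _) x) ?inE ?xb// addrC addKr.
  rewrite subr0; congr meas; apply/setP => t; rewrite !inE.
  by case: eqVneq => // ->; rewrite xb.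
pose ok s' y z := rmem s' 2 (idx y * n + idx z)%N = meas nu (cball d y (d y z) :&: (S :\ x)).
pose old s' y z := rmem s' 2 (idx y * n + idx z)%N = meas nu (cball d y (d y z) :&: S).
apply: (@wp_for_points _ _ _ n_gt0 X nX _ _ (fun i s' => forall y z,
  if (idx y < i)%N then ok s' y z else old s' y z)) => //.
- move=> y s2 fr2 i2 H2.
  have in2 := frame_input fr2 in1 isT isT isT; have [n2 _ _] := in2.
  apply: (@wp_for_points _ _ _ n_gt0 X nX _ _ (fun j s' => forall y' z,
    if (idx y' < idx y)%N || ((y' == y) && (idx z < j)%N) then ok s' y' z
    else old s' y' z)) => //.
  + by move=> y' z; rewrite ltn0 andbF orbF; exact: H2.
  + move=> z s3 fr3 j3 H3.
    have [n3 d3 nu3] := frame_input fr3 in2 isT isT isT.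
    have i3 : imem s3 2 0 = idx y by rewrite fr3.1.
    have f3 : imem s3 6 0 = idx x by rewrite fr3.1// fr2.1.
    have w3 : old s3 y z by have := H3 y z; rewrite eqxx !ltnn.
    apply: wp_loop_free => //=; rewrite i3 j3 f3 n3 !d3 => y' z'.
    rewrite idx_ltS andb_orr orbCA.
    have [/andP[/eqP-> /eqP->]|yz] /= := boolP ((y' == y) && (z' == z)).
      rewrite /ok ball_rem; case: ifP => _ /=; last by rewrite subr0.
      by rewrite /upd /= ?i3 ?j3 ?n3 ?f3 nu3 !eqxx /= w3.
    have := H3 y' z'; case: ifP => _; rewrite /ok /old; case: ifP => _ //=;
      by rewrite /upd /= ?i3 ?j3 ?n3 idx2_eq// (negbTE yz).
  + move=> s3 _ H3 y' z; rewrite idx_ltS; have := H3 y' z.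
    by rewrite idx_lt_n andbT orbC.
- move=> s2 fr2 H2; split=> [y|y z|y z|].
  + by rewrite fr2.1//; exact: k1.
  + by have := H2 y z; rewrite idx_lt_n.
  + by rewrite fr2.2//; exact: g0.
  + by rewrite fr2.2.
Qed.

Lemma peel_prog_spec s : input s -> stores supp s -> rmem s 5 0 = thr ->
  wp peel_prog (fun s' => exists S, [/\ S \subset supp, S != finset.set0,
    well_spread d h nu S & stores S s']) s.
Proof.
move=> ins ts sT; have [sn _ _] := ins.
apply: (@wp_for_points _ _ _ n_gt0 X nX _ _ (fun t s' => exists S,
  [/\ S \subset supp, peeled d h nu S, stores S s' &
      well_spread d h nu S \/ (#|S| + t <= n)%N])) => //.
- exists supp; split=> //; first by left.
  by right; rewrite addn0 max_card.
- move=> x s1 fr1 t1 [S [Ss pS ts1 inv]].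
  have in1 := frame_input fr1 ins isT isT isT.
  have T1 : rmem s1 5 0 = thr by rewrite fr1.2.
  apply: wp_seq => //; apply: wp_conseq (search_prog_spec in1 ts1 T1) _.
  move=> s2 fr2 found2.
  have in2 := frame_input fr2 in1 isT isT isT; have [n2 _ _] := in2.
  have ts2 := frame_stores fr2 ts1 isT isT isT isT.
  apply: wp_if => //=; rewrite addn1 n2 => f2.
    case: found2 => [[fn _]|[y [yS fy lt_y]]]; first by rewrite fn ltnn in f2.
    apply: wp_conseq (remove_prog_spec in2 ts2 fy yS) _ => s3 _ ts3.
    exists (S :\ y); split=> //.
    + by apply: fintype.subset_trans Ss; exact: finset.subsetDl.
    + exact: peeled_step.
    + case: inv => [wS|card]; first by have := wS y yS; rewrite leNgt lt_y.
      by right; move: card; rewrite (cardsD1 y S) yS add1n addSnnS.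
  apply: wp_loop_free => //=.
  case: found2 => [[_ wS]|[y [_ fy _]]]; last by rewrite fy idx_lt_n in f2.
  by exists S; split=> //; left.
- move=> s1 _ [S [Ss pS ts1 inv]]; exists S; have S0 := peeled_neq0 nup Ss pS.
  split=> //; case: inv => // card.
  by move: S0; rewrite -card_gt0 lt0n -leqn0 -(leq_add2r n) add0n card.
Qed.

Lemma spread_prog_spec s : input s ->
  wp spread_prog (fun s' => let S := output_set X s' in
    [/\ S != finset.set0, S \subset supp & well_spread d h nu S]) s.
Proof.
move=> ins.
apply: wp_seq => //; apply: wp_conseq (diam_prog_spec ins) _ => s1 fr1 D1.
have in1 := frame_input fr1 ins isT isT isT.
apply: wp_seq => //; apply: wp_conseq (table_prog_spec in1 D1) _ => s2 fr2 t2.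
have in2 := frame_input fr2 in1 isT isT isT.
have D2 : rmem s2 4 0 = diam d by rewrite fr2.2.
apply: wp_seq => //; apply: wp_conseq (keep_prog_spec in2) _ => s3 fr3 [m3 k3].
have in3 := frame_input fr3 in2 isT isT isT.
have D3 : rmem s3 4 0 = diam d by rewrite fr3.2.
have ts3 : stores supp s3.
  split=> // [x y|x y|].
  - have [t2w _] := t2 x y; rewrite fr3.2// t2w.
    by rewrite -(cond_meas_support nup) /cond_meas meas_support// divr1.
  - by have [_ t2g] := t2 x y; rewrite fr3.2.
  - by rewrite m3 meas_support.
apply: wp_seq => //.
apply: wp_conseq (threshold_prog_spec in3 ts3 D3) _ => s4 fr4 T4.
have in4 := frame_input fr4 in3 isT isT isT.
have ts4 := frame_stores fr4 ts3 isT isT isT isT.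
apply: wp_conseq (peel_prog_spec in4 ts4 T4) _ => s5 _ [S [Ss S0 wS [k5 _ _ _]]] S'.
suff -> : S' = S by [].
by apply/setP => x; rewrite inE -/(idx x) k5 eqb0 negbK.
Qed.
End Correctness.

Theorem theorem1p7 (R : realType) :
  (forall (X : finType) (d : X -> X -> R) (f h : R -> R),
     is_metric d ->
     chaining_functional f h -> log_concave f -> normalized h ->
     (gamma_dual h d - (diam d)%:E <= delta_dual h d)%E /\
     (delta_dual h d <= 2%:E * gamma_dual h d + (diam d / expR 1)%:E)%E)
  /\
  (exists (P : cmd) (C : nat),
     forall (X : finType) (d : X -> X -> R) (f h : R -> R) (nu : X -> R)
            (s : state R),
       is_metric d ->
       chaining_functional f h -> log_concave f -> normalized h ->
       is_prob nu ->
       holds_input d nu s ->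
       exists (s' : state R) (k : nat),
         [/\ exec h P s s' k,
             (k <= C * #|X| ^ 3)%N &
             let S := output_set X s' in
             [/\ S != finset.set0,
                 (forall x : X, x \in S -> 0 < nu x) &
                 (avg_chain_int h d nu nu <=
                    \big[mine/+oo]_(x in S) chain_int h d (cond_meas nu S) x
                    + (diam d)%:E)%E]]).
Proof.
split=> [X d f h dm fh lc nh|].
  have hp := chaining_profileP fh lc nh.
  by split; [exact: gamma_dual_le|exact: delta_dual_le].
exists spread_prog, (cost_coef spread_prog) => X d f h nu s dm fh lc nh nup ins.
have hp := chaining_profileP fh lc nh.
have [s' [k [ex kb [S0 Ss wS]]]] := spread_prog_spec dm hp nup ins.
exists s', k; split=> //; split=> //; last exact: well_spread_min.
by move=> x xS; have := fintype.subsetP Ss x xS; rewrite inE.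
Qed.
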